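(* Let $1\le l\le k$ and $a,b\ge0$ be integers with $a+b\le l$. Let $[a,b]_l=\iota\bigl(C^{(k,l)}_{a,b}\bigr)\subset R^{(l)}$, where $C^{(k,l)}_{a,b}=\{\mathbf a\in C^{(k,l)}_{\rm pos}: a_0=a,\ a_1=b\}$. Then $[a,b]_l$ is independent of $k$, and is given by $$[a,b]_l=\begin{cases}R^{(l)}(\mathbf r_{a,b})_{[a,a+b],[a+b,l]}&\text{if }a\ne0,\\ R^{(l)}(\mathbf r_{a,b})_{[b,l]}&\text{if }a=0\text{ and }b\neq0,\\ R^{(l)}(\mathbf r_{a,b})&\text{if }a=0\text{ and }b=0,\end{cases}$$ where $$\mathbf r_{a,b}=(\underbrace{0,\dots,0}_{a},\underbrace{1,2,\dots,b}_{b},\underbrace{b+2,b+4,\dots,2l-2a-b}_{l-a-b}),$$ and $[l_1,l_2]=\{l_1,l_1+1,\dots,l_2\}$ for $1\le l_1\le l_2\le l$.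
   Context: **Configurations.** A configuration is a sequence $\mathbf a=(a_i)_{i\in\mathbb Z}$ of non-negative integers; it is finite if $a_i=0$ for all but finitely many $i$. $C^{(k)}$ is the set of finite configurations with $a_i+a_{i+1}+a_{i+2}\le k$ for all $i$. Put $S[i,\mathbf a]=a_i+a_{i+1}$, $L[i,\mathbf a]=a_{i-1}+2a_i+2a_{i+1}+a_{i+2}$. For $0\le l\le k$, $C^{(k,l)}$ is the set of $\mathbf a\in C^{(k)}$ with $S[i,\mathbf a]\le l$ and $L[i,\mathbf a]\le k+l$ for all $i$ (so $C^{(k,0)}=\{\mathbf 0\}$). $C^{(k,l)}_{\rm pos}$ is the set of $\mathbf a\in C^{(k,l)}$ with $a_i=0$ for all $i<0$. For $1\le l\le k$, $\underline C^{(k,l)}=C^{(k,l)}\setminus C^{(k,l-1)}$. Put $A_{l,l'}=2\min(l,l')+\max(l+l'-k,0)$. **Rigged partitions.** A rigged partition is a pair $(\lambda,\rho)$ with $\lambda=(\lambda_1\ge\dots\ge\lambda_n\ge1)$ a partition ($n\ge0$) and $\rho\in\mathbb Z^n$ such that $\rho_i\ge\rho_{i+1}$ whenever $\lambda_i=\lambda_{i+1}$; $\emptyset$ denotes the one with $n=0$. $R^{(l)}$ is the set of rigged partitions with $\lambda_1\le l$. For a sequence of non-negative integers $\mathbf r=(r_1,\dots,r_l)$, $R^{(l)}(\mathbf r)=\{(\lambda,\rho)\in R^{(l)}:\rho_i\ge r_{\lambda_i}\text{ for all }i\}$. For $J\subset\{1,\dots,l\}$, $\mathbf r(J)$ is the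 sequence with $\mathbf r(J)_i=r_i+1$ if $i\in J$ and $r_i$ otherwise. For nonempty subsets $J_1,\dots,J_n\subset\{1,\dots,l\}$, $R^{(l)}(\mathbf r)_{J_1,\dots,J_n}=R^{(l)}(\mathbf r)\setminus\bigcup_{m=1}^nR^{(l)}(\mathbf r(J_m))$. **The map $\iota$.** For $\mathbf a\in\underline C^{(k,l)}$, $l\ge1$, let $i_1$ be the largest integer $i$ with $S[i,\mathbf a]=l$ or $L[i,\mathbf a]=k+l$; the right move $M_+\mathbf a\in\underline C^{(k,l)}$ is obtained from $\mathbf a$ by replacing $(a_{i_1},a_{i_1+1})$ by $(a_{i_1}-1,a_{i_1+1}+1)$. $\mathbf a\in\underline C^{(k,l)}$ contains a free particle of weight $l$ at the highest position $i$ if $a_i+a_{i+1}=l$, $a_i\ne0$ and $a_j=0$ for all $j\ge i+2$. The map $\iota:C^{(k,l)}\to R^{(l)}$ is defined inductively on $\sum_ia_i$: $\iota(\mathbf 0)=\emptyset$. For $\mathbf a\ne\mathbf 0$ let $l_0\ge1$ be the integer with $\mathbf a\in\underline C^{(k,l_0)}$. For all sufficiently large $t$, $M_+^t\mathbf a$ contains a free particle of weight $l_0$ at the highest position $i$ for some $i$; with $c=(M_+^t\mathbf a)_i$ put $d=ic+(i+1)(l_0-c)$, $s=d-t$, and let $\overline{\mathbf a}$ be obtained from $M_+^t\mathbf a$ by setting the entries at columns $i,i+1$ to $0$ ($s$ and $\overline{\mathbf a}$ do not depend on $t$). If $\iota(\overline{\mathbf a})=(\overline\lambda,\overline\rho)$,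 then $\iota(\mathbf a)=((l_0,\overline\lambda),(\rho_1,\overline\rho))$ with $\rho_1=s-\sum_jA_{l_0,\overline\lambda_j}$. *)

(* Defs.v *)
From HB Require Import structures.
From mathcomp Require Import all_boot all_order all_algebra.
From mathcomp Require Import finmap classical_sets.

Set Implicit Arguments.
Unset Strict Implicit.
Unset Printing Implicit Defensive.

Import Order.TTheory GRing.Theory Num.Theory.
Local Open Scope classical_set_scope.

(* Finite configurations: finitely supported functions int -> nat. *)
Definition config := {fsfun int -> nat with 0}.

(* Positions are added in int ([%R]); multiplicities are added in nat. *)
Definition S2 (i : int) (c : config) : nat := c i + c (i + 1)%R.

Definition L4 (i : int) (c : config) : nat :=
  c (i - 1)%R + 2 * c i + 2 * c (i + 1)%R + c (i + 2)%R.

Definition Ck (k : nat) : set config :=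
  [set c | forall i : int, c i + c (i + 1)%R + c (i + 2)%R <= k].

Definition Ckl (k l : nat) : set config :=
  [set c | Ck k c /\ forall i : int, S2 i c <= l /\ L4 i c <= k + l].

Definition Ckl_pos (k l : nat) : set config :=
  [set c | Ckl k l c /\ forall i : int, (i < 0)%R -> c i = 0].

(* Meaningful for 1 <= l <= k. *)
Definition underC (k l : nat) : set config := Ckl k l `\` Ckl k l.-1.

Definition Cab (k l a b : nat) : set config :=
  [set c | [/\ Ckl_pos k l c, c 0%R = a & c 1%R = b]].

(* max (l + l' - k, 0) is the truncated subtraction of nat. *)
Definition Amat (k l l' : nat) : nat := 2 * minn l l' + (l + l' - k).

(* A rigged partition is a pair (lambda, rho) of sequences of the same
   length, indexed from 0 by [nth]. *)
Definition rigged_pair := (seq nat * seq int)%type.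

Definition rigged : set rigged_pair :=
  [set x | [/\ size x.1 = size x.2,
               sorted geq x.1,
               all (leq 1) x.1
             & forall i, i.+1 < size x.1 ->
                 nth 0 x.1 i = nth 0 x.1 i.+1 ->
                 (nth 0%R x.2 i.+1 <= nth 0%R x.2 i)%R]].

Definition Rl (l : nat) : set rigged_pair :=
  [set x | rigged x /\ head 0 x.1 <= l].

(* A sequence (r_1, ..., r_l) is a [seq nat]; r_j is its item number j.-1. *)
Definition Rlr (l : nat) (r : seq nat) : set rigged_pair :=
  [set x | Rl l x /\
     forall i, i < size x.1 ->
       ((nth 0%N r (nth 0%N x.1 i).-1)%:Z <= nth 0%R x.2 i)%R].

(* r(J), for J a set of 1-based indices. *)
Definition bump_at (r : seq nat) (J : pred nat) : seq nat :=
  mkseq (fun i => nth 0 r i + J i.+1) (size r).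

Definition RlrJ (l : nat) (r : seq nat) (Js : seq (pred nat)) :
    set rigged_pair :=
  Rlr l r `\` \big[setU/set0]_(J <- Js) Rlr l (bump_at r J).

Definition itv_nat (l1 l2 : nat) : pred nat := fun i => l1 <= i <= l2.

(* In the definitions below, [xget x0 P] is an element of P, with the junk
   value x0 when P is empty. *)

Definition last_crit (k l : nat) (c : config) : int :=
  let crit i := S2 i c = l \/ L4 i c = k + l in
  xget 0%R [set i | crit i /\ forall j : int, crit j -> (j <= i)%R].

Definition Mplus (k l : nat) (c : config) : config :=
  let i := last_crit k l c in
  [fsfun c with i |-> c i - 1, (i + 1)%R |-> c (i + 1)%R + 1].

Definition free_at (l : nat) (c : config) (i : int) : Prop :=
  [/\ c i + c (i + 1)%R = l,
      c i <> 0
    & forall j : int, (i + 2 <= j)%R -> c j = 0].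

Definition level (k : nat) (c : config) : nat :=
  xget 0 [set l | 1 <= l <= k /\ underC k l c].

(* A time from which on M_+^t c has a free particle at the highest position;
   which one is chosen does not affect s and the remaining configuration. *)
Definition free_time (k l : nat) (c : config) : nat :=
  xget 0 [set T | forall t, T <= t ->
                    exists i, free_at l (iter t (Mplus k l) c) i].

Definition weight (c : config) : nat := \sum_(i <- finsupp c) c i.

(* The recursion is on the weight, which drops by l >= 1 at each step, so that
   [weight c] is enough fuel for [iotaC]. *)
Fixpoint iota_rec (k fuel : nat) (c : config) : rigged_pair :=
  if fuel is n.+1 then
    if c == [fsfun] then ([::], [::]) else
    let l := level k c in
    let t := free_time k l c in
    let m := iter t (Mplus k l) c in
    let i := xget 0%R [set i | free_at l m i] in
    let d := (i * (m i)%:Z + (i + 1) * (l%:Z - (m i)%:Z))%R in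
    let s := (d - t%:Z)%R in
    let x := iota_rec k n [fsfun m with i |-> 0, (i + 1)%R |-> 0] in
    (l :: x.1, (s - (\sum_(j <- x.1) Amat k l j)%N%:Z)%R :: x.2)
  else ([::], [::]).

Definition iotaC (k : nat) (c : config) : rigged_pair :=
  iota_rec k (weight c) c.

Definition bracket (k l a b : nat) : set rigged_pair :=
  iotaC k @` Cab k l a b.

Definition r_ab (l a b : nat) : seq nat :=
  nseq a 0 ++ iota 1 b ++ [seq b + 2 * j | j <- iota 1 (l - a - b)].

(* Main.v *)
From Stdlib Require Import ZArith Lia FunctionalExtensionality Classical.
Require Import Defs.
From mathcomp Require Import all_boot all_order all_algebra.
From mathcomp Require Import finmap classical_sets.

(** Why the theorem holds.

    The map [iota] peels off particles, heaviest first: moves to the right carry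
    a particle of weight [l] out of the configuration, through everything that
    stands on its right.  The proof inverts one such step by a closed formula.

    Write T_i = f_i + f_(i+1) + f_(i+2) and d = k - l.  Reading a configuration
    [f] of level at most [l] from right to left, put
    w_i = min (f_i, k - T_(i-1), d - w_(i+1))  ([greedy]).  When a particle of
    weight [l] passes through [f] from right to left, h_m = T_(m-2) - w_(m-2)
    particles cross the right border of column [m]; always
    f_(m-1) + f_m <= h_m <= l ([lag_bounds]).  Let D be the function with
    D_m = l m far to the left and D_(m+1) - D_m = l - h_m ([crossing]).  The
    configuration in which [f] is met by an [l]-particle of rigging [rho] is
        a_m = f_m + e_(m+1) - 2 e_m + e_(m-1),   e_m = max (D_m - rho, 0)
    ([inserted]): left of the cut, the [i] with D_i <= rho < D_(i+1), it is
    [f]; right of it, it is [f] after the passage.  Three facts carry the proof.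

    - [inserted_admissible]: [a] satisfies all the inequalities and its last
      critical site is the cut [i].  As D_m - rho drops by one when [rho] grows
      by one, the right move changes [rho] into [rho + 1] ([inserted_step]).
      Right moves are injective ([right_move_inj]), so every configuration whose
      orbit ends in [f] and a free particle is an insertion into [f].
    - If [f] itself has a last particle of weight [l] and rigging [r], then [a]
      is correct exactly for [rho >= r]: the thresholds of [f] next to its own
      last critical site both equal [r] ([crossing_of_inserted]), and the
      insertion with [rho = r] has no predecessor ([inserted_no_pred]).  This is
      the monotonicity of riggings of equal weight.
    - The total lag of an [l]-particle, the limit of l m - D_m, is the sum of
      the A_(l,l') over the particles of [f] ([assembled_lag]): it is invariant
      under right moves in [f] ([crossing_right_move]), hence can be computed
      when the particles of [f] are far apart ([crossing_free]).

    Together they show that [iota] is a bijection and compute its inverse.  Now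
    look at columns 0 and 1.  If [f] vanishes in negative columns, then h_m is 0
    for m < 0, h_0 = f_0 and h_1 = f_0 + f_1, so D_0 = 0, D_1 = l - f_0 and
    D_2 = 2l - 2 f_0 - f_1; neither [k] nor [w] enters.  The formula for [a]
    gives
        a_0 = max (f_0, l - rho),   2 a_0 + a_1 = max (2 f_0 + f_1, 2l - rho),
    and [a] vanishes in negative columns iff [f] does and rho >= 0.  By
    induction ([assembled_left_end]) the non-negative configurations with
    a_0 = a and a_1 = b correspond to the rigged partitions with all
    rho_i >= 0, max (0, lambda_i - rho_i) = a and
    max (0, 2 lambda_i - rho_i) = 2a + b, maxima over all particles.  The
    upper bounds say rho_i >= max (0, lambda_i - a, 2 lambda_i - 2a - b), which
    is the sequence r_(a,b); equality in one of them can only happen for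
    lambda_i in [[a, a+b]], respectively [[a+b, l]], which is what the removed
    sets express (for a = 0 the first maximum is attained by 0). *)

Set Implicit Arguments.
Unset Strict Implicit.
Unset Printing Implicit Defensive.

Import Order.TTheory GRing.Theory Num.Theory.

Local Open Scope Z_scope.

(** * Linear arithmetic with shifted indices *)

(** Terms such as [f (i - 1 + 2)] are distinct atoms for [lia] unless their
    arguments are brought to the form [i], [i + n] or [i - n]; [idx] does this
    in the goal, [spec H t] in the instance [H t]. *)
Ltac is_cst b := lazymatch b with Zpos _ => idtac | Z0 => idtac | Zneg _ => idtac end.
Ltac split_offset t :=
  lazymatch t with
  | ?a + ?b =>
    let _ := match goal with _ => is_cst b end in
    let p := split_offset a in
    lazymatch p with (?u, ?o) =>
      let o' := eval compute in (o + b) in constr:((u, o')) end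
  | ?a - ?b =>
    let _ := match goal with _ => is_cst b end in
    let p := split_offset a in
    lazymatch p with (?u, ?o) =>
      let o' := eval compute in (o - b) in constr:((u, o')) end
  | _ => constr:((t, 0))
  end.
Ltac canon t :=
  let p := split_offset t in
  lazymatch p with
  | (?u, Z0) => u
  | (?u, Zpos ?n) => constr:(u + Zpos n)
  | (?u, Zneg ?n) => constr:(u - Zpos n)
  end.

Ltac idx_in H :=
  repeat match type of H with context [?f ?t] =>
    lazymatch type of f with Z -> Z =>
      let t' := canon t in
      tryif constr_eq t t' then fail else
        replace t with t' in H by ring end end.
Ltac idx :=
  repeat match goal with |- context [?f ?t] =>
    lazymatch type of f with Z -> Z =>
      let t' := canon t in
      tryif constr_eq t t' then fail else
        replace t with t' by ring end end.
Ltac spec H t := let X := fresh "X" in pose proof (H t) as X; cbv beta in X; idx_in X.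

Ltac cases_test :=
  repeat match goal with
  | |- context [Z.eqb ?a ?b] => destruct (Z.eqb_spec a b); try lia
  | |- context [Z.ltb ?a ?b] => destruct (Z.ltb_spec a b); try lia
  end.

Lemma downward_ind (P : Z -> Prop) B :
  (forall m, B <= m -> P m) -> (forall m, P (m + 1) -> P m) -> forall m, P m.
Proof.
move=> HB Hs m.
suff H : forall n : nat, P (B - Z.of_nat n).
  case: (Z.le_gt_cases B m) => [|Hm]; first exact: HB.
  have -> : m = B - Z.of_nat (Z.to_nat (B - m)) by lia.
  exact: H.
elim=> [|n IH]; first by apply: HB; lia.
by apply: Hs; have -> : B - Z.of_nat (S n) + 1 = B - Z.of_nat n by lia.
Qed.

Lemma downward_ind_from (P : Z -> Prop) B :
  P B -> (forall m, m < B -> P (m + 1) -> P m) -> forall m, m <= B -> P m.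
Proof.
move=> HB Hs m; apply: (downward_ind (B := B) (P := fun m => m <= B -> P m)).
  by move=> n H1 H2; have -> : n = B by lia.
move=> n IH Hn; case: (Z.eq_dec n B) => [->//|Hne].
by apply: Hs; [lia|apply: IH; lia].
Qed.

Lemma upward_ind_from (P : Z -> Prop) B :
  P B -> (forall m, B <= m -> P m -> P (m + 1)) -> forall m, B <= m -> P m.
Proof.
move=> HB Hs m Hm.
have -> : m = B + Z.of_nat (Z.to_nat (m - B)) by lia.
elim: (Z.to_nat _) => [|n IH]; first by have -> : B + Z.of_nat 0 = B by lia.
have -> : B + Z.of_nat (S n) = B + Z.of_nat n + 1 by lia.
by apply: Hs => //; lia.
Qed.

Lemma prefix_sum (f : Z -> Z) A : (forall m, m < A -> f m = 0) ->
  exists P, (forall m, P (m + 1) = P m + f m) /\ forall m, m <= A -> P m = 0.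
Proof.
move=> HA.
pose P := fix P (n : nat) := match n with
  | O => 0
  | S n' => P n' + f (A + Z.of_nat n') end.
have P0 : P O = 0 by [].
have PS n : P (S n) = P n + f (A + Z.of_nat n) by [].
have PA m : m <= A -> P (Z.to_nat (m - A)) = 0.
  by move=> Hm; have -> : Z.to_nat (m - A) = O by lia.
exists (fun m => P (Z.to_nat (m - A))); split=> [m|]; last exact: PA.
case: (Z.le_gt_cases A m) => Hm; last by rewrite !PA ?HA //; lia.
have -> : Z.to_nat (m + 1 - A) = S (Z.to_nat (m - A)) by lia.
by rewrite PS; have -> : A + Z.of_nat (Z.to_nat (m - A)) = m by lia.
Qed.

(** * Configurations and the greedy weights *)

(** The inequalities defining C^(k,l), for functions on Z with values in Z. *)
Record admissible (k l : Z) (f : Z -> Z) : Prop := Adm {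
  adm_ge0 : forall i, 0 <= f i;
  adm_triple : forall i, f i + f (i + 1) + f (i + 2) <= k;
  adm_pair : forall i, f i + f (i + 1) <= l;
  adm_quad : forall i, f (i - 1) + 2 * f i + 2 * f (i + 1) + f (i + 2) <= k + l
}.

Arguments adm_ge0 {k l f} _ i.
Arguments adm_triple {k l f} _ i.
Arguments adm_pair {k l f} _ i.
Arguments adm_quad {k l f} _ i.

Definition critical (k l : Z) (f : Z -> Z) (i : Z) : Prop :=
  f i + f (i + 1) = l \/
  f (i - 1) + 2 * f i + 2 * f (i + 1) + f (i + 2) = k + l.

Definition noncritical (k l : Z) (f : Z -> Z) (i : Z) : Prop :=
  f i + f (i + 1) < l /\
  f (i - 1) + 2 * f i + 2 * f (i + 1) + f (i + 2) < k + l.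

Definition last_critical (k l : Z) (f : Z -> Z) (i : Z) : Prop :=
  critical k l f i /\ forall j, i < j -> noncritical k l f j.

Definition finite (f : Z -> Z) : Prop :=
  exists B, forall m, m < - B \/ B < m -> f m = 0.

(** Any [w] with this recursion maximizes the sum of [w] subject to
    0 <= w_m <= f_m, w_m <= k - (f_(m-1) + f_m + f_(m+1)) and
    w_m + w_(m+1) <= d.  If d is at most [k] minus the level of [f], this maximum
    is the sum of min (lambda_j, d) over the particles of [f]. *)
Definition greedy (k d : Z) (f w : Z -> Z) : Prop :=
  (exists B, forall m, B <= m -> w m = 0) /\
  forall m, w m = Z.min (Z.min (f m) (k - (f (m - 1) + f m + f (m + 1))))
                        (d - w (m + 1)).

(** For riggings below [D m] the inserted [l]-particle stands on the left of
    column [m]; the bracket is the number of particles that its passage carries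
    across the right border of column [m]. *)
Definition crossing (k l : Z) (f w D : Z -> Z) : Prop :=
  (exists A, forall m, m <= A -> D m = l * m) /\
  forall m, D (m + 1) = D m + l - (f (m - 2) + f (m - 1) + f m - w (m - 2)).

(** In terms of tau_m(f), the sum of (m - j) f_j over j < m, this reads
    tau_m(a) = tau_m(f) + max (D_m - rho, 0). *)
Definition inserted (f D : Z -> Z) (rho : Z) (a : Z -> Z) : Prop :=
  forall m, a m = f m + Z.max (D (m + 1) - rho) 0
                  - 2 * Z.max (D m - rho) 0 + Z.max (D (m - 1) - rho) 0.

Lemma admissible_mono k l l' f : l <= l' -> admissible k l f -> admissible k l' f.
Proof.
move=> Hl [H0 HT HS HL]; split=> // i; [spec HS i | spec HL i]; lia.
Qed.

Lemma admissible_noncritical k l l' f i : l < l' -> admissible k l f ->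
  noncritical k l' f i.
Proof. by move=> Hl [H0 HT HS HL]; split; [spec HS i | spec HL i]; lia. Qed.

Lemma greedy_exists k d l f : 0 <= d -> admissible k l f -> finite f ->
  exists w, greedy k d f w.
Proof.
move=> Hd Ha [B HB].
pose G := fix G (n : nat) := match n with
  | O => 0
  | S n' => let m := B + 1 - Z.of_nat n in
     Z.min (Z.min (f m) (k - (f (m - 1) + f m + f (m + 1)))) (d - G n') end.
have HG n : G (S n) = let m := B + 1 - Z.of_nat (S n) in
     Z.min (Z.min (f m) (k - (f (m - 1) + f m + f (m + 1)))) (d - G n) by [].
exists (fun m => G (Z.to_nat (B + 1 - m))); split.
  exists (B + 1) => m Hm; by have -> : Z.to_nat (B + 1 - m) = 0%nat by lia.
move=> m; case: (Z.le_gt_cases m B) => Hm.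
  have -> : Z.to_nat (B + 1 - m) = S (Z.to_nat (B + 1 - (m + 1))) by lia.
  rewrite HG; cbv zeta.
  by have -> : B + 1 - Z.of_nat (S (Z.to_nat (B + 1 - (m + 1)))) = m by lia.
have -> : Z.to_nat (B + 1 - m) = 0%nat by lia.
have -> : Z.to_nat (B + 1 - (m + 1)) = 0%nat by lia.
rewrite /= HB; last by right; lia.
spec (adm_triple Ha) (m - 1); have := HB m; lia.
Qed.

Lemma greedy_bounds k d l f w : 0 <= d -> admissible k l f -> greedy k d f w ->
  forall m, 0 <= w m /\ w m <= f m /\
    w m <= k - (f (m - 1) + f m + f (m + 1)) /\ w m + w (m + 1) <= d /\
    (w m = f m \/ w m = k - (f (m - 1) + f m + f (m + 1)) \/
     w m = d - w (m + 1)).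
Proof.
move=> Hd Ha [[B HB] Hw].
have H : forall m, 0 <= w m <= d.
  apply: (downward_ind (B := B)) => m Hm; first by rewrite HB.
  by rewrite Hw; spec (adm_triple Ha) (m - 1); spec (adm_ge0 Ha) m; spec Hw (m + 1); lia.
by move=> m; spec H m; spec H (m + 1); spec Hw m; lia.
Qed.

(** * Insertion of a particle *)

Section Insertion.
Variables (k l : Z) (f w D : Z -> Z).
Hypotheses (hl : 0 <= l <= k) (Ha : admissible k l f) (Hw : greedy k (k - l) f w)
  (HD : crossing k l f w D).

Let hd : 0 <= k - l. Proof. lia. Qed.

(** The three terms of the minimum defining w_(m-2) give, in this order, the
    pair inequality, the quadruple inequality and, as w_(m-1) is itself
    bounded by k - T_(m-2), again [l]. *)
Lemma lag_bounds m :
  f (m - 1) + f m <= f (m - 2) + f (m - 1) + f m - w (m - 2) <= l.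
Proof.
have G := greedy_bounds hd Ha Hw; spec G (m - 2); spec G (m - 1).
spec (adm_pair Ha) (m - 1); spec (adm_quad Ha) (m - 2); lia.
Qed.

Lemma crossing_mono m n : m <= n -> D m <= D n.
Proof.
move: n; apply: upward_ind_from => [|n _ IH]; first lia.
spec (proj2 HD) n; have := lag_bounds n; lia.
Qed.

(** Only the columns [i] and [i + 1] around the cut depend on [rho]; further
    right the second differences of [D] are the differences of the lag. *)
Lemma inserted_shape rho a i : inserted f D rho a -> D i <= rho < D (i + 1) ->
  [/\ forall m, m < i -> a m = f m,
      a i = f i + (D (i + 1) - rho),
      a (i + 1) = f (i + 1) + l - (f (i - 1) + f i + f (i + 1) - w (i - 1))
                  - (D (i + 1) - rho),
      forall m, i + 2 <= m -> a m = f (m - 3) + w (m - 2) - w (m - 3) &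
      1 <= D (i + 1) - rho <= l - (f (i - 2) + f (i - 1) + f i - w (i - 2))].
Proof.
move=> Hi Hc; split.
- move=> m Hm; rewrite Hi.
  have := @crossing_mono (m + 1) i; have := @crossing_mono m i.
  have := @crossing_mono (m - 1) i; lia.
- rewrite Hi; have := @crossing_mono (i - 1) i; lia.
- have := @crossing_mono (i + 1) (i + 2).
  rewrite Hi; spec (proj2 HD) (i + 1); idx; lia.
- move=> m Hm; rewrite Hi.
  have := @crossing_mono (i + 1) (m + 1); have := @crossing_mono (i + 1) m.
  have := @crossing_mono (i + 1) (m - 1).
  spec (proj2 HD) m; spec (proj2 HD) (m - 1); lia.
- spec (proj2 HD) i; lia.
Qed.

End Insertion.

(** The triple sums that meet the cut are
    T_(i-1)(a) = l + w_(i-1) and T_i(a) = l + w_i, while T_(i-2)(a) and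
    T_(i+1)(a) are at most l + w_(i-2) and l + w_(i+1); since a quadruple is the
    sum of two consecutive triples and w_m + w_(m+1) <= k - l, the inequalities
    around the cut follow.  A window further right is a window of [f] three
    columns back, corrected by [w]; whichever term attains the minimum in the
    greedy recursion, it is bounded by a neighbouring window of [f].  The site [i] is critical because w_(i-1) = f_(i-1) or
    w_(i-1) + w_i = k - l; the third possibility, w_(i-1) = k - T_(i-2), would
    force the lag at [i] to be [l], that is D_i = D_(i+1). *)
Lemma inserted_admissible k l f w D rho a i :
  1 <= l <= k -> admissible k l f -> greedy k (k - l) f w -> crossing k l f w D ->
  (forall s, i - 1 <= s -> noncritical k l f s) ->
  inserted f D rho a -> D i <= rho < D (i + 1) ->
  admissible k l a /\ last_critical k l a i.
Proof.
move=> Hl Ha Hw HD Hq Hi Hc.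
have hl : 0 <= l <= k by lia.
have hd : 0 <= k - l by lia.
have [A1 A2 A3 A4] := inserted_shape hl Ha Hw HD Hi Hc.
move: (D (i + 1) - rho) A2 A3 => y A2 A3 Hy {Hi Hc HD}.
have G := greedy_bounds hd Ha Hw.
have lag := lag_bounds hl Ha Hw.
have HT := adm_triple Ha; have HS := adm_pair Ha; have HL := adm_quad Ha.
have H0 := adm_ge0 Ha.
have RS s : i + 2 <= s -> a s + a (s + 1) < l.
  move=> Hs; rewrite !A4; try lia; idx.
  have := Hq (s - 3); have := Hq (s - 2); rewrite /noncritical; idx.
  spec G (s - 3); spec G (s - 2); spec G (s - 1); lia.
have RT s : i + 2 <= s -> a s + a (s + 1) + a (s + 2) <= k.
  move=> Hs; rewrite !A4; try lia; idx.
  spec lag (s - 1); spec G s; spec G (s + 1); lia.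
have RL s : i + 3 <= s ->
    a (s - 1) + 2 * a s + 2 * a (s + 1) + a (s + 2) < k + l.
  move=> Hs; rewrite !A4; try lia; idx.
  have := Hq (s - 4); have := Hq (s - 3); have := Hq (s - 2); rewrite /noncritical; idx.
  spec lag (s - 1); spec HT (s - 3).
  spec G (s - 4); spec G (s - 3); spec G (s - 2); spec G (s - 1); spec G s; lia.
have B1 : a (i - 1) = f (i - 1) by apply: A1; lia.
have B2 : a (i - 2) = f (i - 2) by apply: A1; lia.
have B3 : a (i - 3) = f (i - 3) by apply: A1; lia.
have C2 : a (i + 2) = f (i - 1) + w i - w (i - 1) by rewrite A4; [idx|lia].
have C3 : a (i + 3) = f i + w (i + 1) - w i by rewrite A4; [idx|lia].
have C4 : a (i + 4) = f (i + 1) + w (i + 2) - w (i + 1) by rewrite A4; [idx|lia].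
spec G (i - 3); spec G (i - 2); spec G (i - 1); spec G i; spec G (i + 1).
(* triple sums of [a] around the cut *)
have T0 : f (i - 2) + f (i - 1) + a i <= l + w (i - 2) by lia.
have T1 : f (i - 1) + a i + a (i + 1) = l + w (i - 1) by lia.
have T2 : a i + a (i + 1) + a (i + 2) = l + w i by lia.
have T3 : a (i + 1) + a (i + 2) + a (i + 3) <= l + w (i + 1) - 1 by lia.
have T4 : a (i + 2) + a (i + 3) + a (i + 4) <= l + w (i + 2).
  by spec lag (i + 1); lia.
have N : a (i + 1) >= 0 by spec lag (i + 1); lia.
have Ra : forall s, i < s -> noncritical k l a s.
  move=> s Hs; have [H|[H|H]] : i + 3 <= s \/ s = i + 2 \/ s = i + 1 by lia.
  - by split; [apply: RS|apply: RL]; lia.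
  - by split; [apply: RS; lia|]; rewrite H; idx; spec G (i + 2); lia.
  - by rewrite H; split; idx; spec G (i + 2); lia.
have Ca : critical k l a i.
  rewrite /critical B1; have C : w (i - 1) = f (i - 1) \/ w (i - 1) + w i = k - l.
    by spec G (i - 2); spec G (i - 1); spec HL (i - 3); spec HT (i - 3); lia.
  lia.
split; last by [].
have Hs s : s <= i -> a s + a (s + 1) <= l /\
   a (s - 1) + 2 * a s + 2 * a (s + 1) + a (s + 2) <= k + l.
  move=> Hs; have [H|[->|[->|->]]] : s <= i - 3 \/ s = i - 2 \/ s = i - 1 \/ s = i by lia.
  - by rewrite !A1; try lia; spec HS s; spec HL s; lia.
  - by idx; spec HS (i - 2); lia.
  - idx; lia.
  - idx; lia.
split.
- move=> m; have [H|[->|[->|H]]] : m < i \/ m = i \/ m = i + 1 \/ i + 2 <= m by lia.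
  + by rewrite A1.
  + by spec H0 i; lia.
  + lia.
  + by rewrite A4 //; spec G (m - 3); spec G (m - 2); lia.
- move=> s; have [H|[->|[->|[->|[->|H]]]]] : s <= i - 3 \/ s = i - 2 \/
    s = i - 1 \/ s = i \/ s = i + 1 \/ i + 2 <= s by lia.
  + by rewrite !A1; try lia.
  + idx; lia.
  + idx; lia.
  + idx; lia.
  + idx; lia.
  + exact: RT.
- by move=> s; case: (Z.le_gt_cases s i) => H; [apply Hs|have [] := Ra s; lia].
- by move=> s; case: (Z.le_gt_cases s i) => H; [apply Hs|have [] := Ra s; lia].
Qed.

(** * Right moves *)

Definition right_move (f : Z -> Z) (i : Z) : Z -> Z :=
  fun m => if Z.eqb m i then f m - 1 else
           if Z.eqb m (i + 1) then f m + 1 else f m.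

Lemma right_moveE f i m : (m = i -> right_move f i m = f m - 1) /\
  (m = i + 1 -> right_move f i m = f m + 1) /\
  (m <> i -> m <> i + 1 -> right_move f i m = f m).
Proof.
by rewrite /right_move; cases_test; lia.
Qed.

Lemma last_critical_uniq k l f i j :
  last_critical k l f i -> last_critical k l f j -> i = j.
Proof.
move=> [ci Hi] [cj Hj]; case: (Z.lt_trichotomy i j) => [H|[//|H]].
  by have := Hi j H; unfold critical, noncritical in *; lia.
by have := Hj i H; unfold critical, noncritical in *; lia.
Qed.

(** Raising [rho] by one lowers the positive part of D_m - rho by one exactly
    for m > i; the second difference of this step is -1 at [i] and +1 at
    [i + 1]. *)
Lemma inserted_step k l f w D rho a i : 0 <= l <= k -> admissible k l f ->
  greedy k (k - l) f w -> crossing k l f w D ->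
  inserted f D rho a -> D i <= rho < D (i + 1) ->
  inserted f D (rho + 1) (right_move a i).
Proof.
move=> Hl Ha Hw HD Hi Hc m; have M := crossing_mono Hl Ha Hw HD.
have := right_moveE a i m; rewrite Hi.
have := M (m - 1) m; have := M m (m + 1).
have [H|[H|[->|[->|[H|H]]]]] : m < i - 1 \/ m = i - 1 \/ m = i \/
    m = i + 1 \/ m = i + 2 \/ m > i + 2 by lia.
- have := M (m + 1) i; lia.
- have := M (m + 1) i; rewrite H; idx; lia.
- idx; lia.
- idx; lia.
- rewrite H; idx; lia.
- have := M (i + 1) (m - 1); lia.
Qed.

Lemma crossing_agree k l f w D g v E i :
  crossing k l f w D -> crossing k l g v E ->
  (forall m, m < i -> f m = g m) -> (forall m, m < i - 1 -> w m = v m) ->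
  forall m, m <= i -> D m = E m.
Proof.
move=> [[A HA] HD] [[B HB] HE] Hf Hw m Hm.
suff H : forall n, Z.min (Z.min A B) i <= n -> n <= i -> D n = E n.
  case: (Z.le_gt_cases m (Z.min (Z.min A B) i)) => H1; last by apply: H; lia.
  by rewrite HA ?HB //; lia.
apply: upward_ind_from => [_|n Hn IH Hi]; first by rewrite HA ?HB //; lia.
rewrite HD HE IH; last lia.
by rewrite !Hf ?Hw; lia.
Qed.

Lemma greedy_agree k d f w g v i : greedy k d f w -> greedy k d g v ->
  (forall m, m <= i -> f m = g m) -> w i = v i -> forall m, m <= i -> w m = v m.
Proof.
move=> [_ Hw] [_ Hv] Hf Hi; apply: downward_ind_from => // m Hm IH.
by rewrite Hw Hv IH !Hf; lia.
Qed.

(** Insertion into an insertion of the same weight.  The window sums around the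
    cut [j] of [f] give w_j <= k - T_(j-1)(f) = k - l - v_(j-1) and
    w_(j+1) <= k - T_j(f) = k - l - v_j, and these caps force
    w_(j-1) = v_(j-1).  So on the left of [j] the lag through [f] is that
    through [g]; at [j] it grows by the excess f_j - g_j, and at [j + 1] it is
    [l]. *)
Lemma crossing_of_inserted k l g v E r f w D j :
  1 <= l <= k -> admissible k l g -> greedy k (k - l) g v -> crossing k l g v E ->
  inserted g E r f -> E j <= r < E (j + 1) -> admissible k l f ->
  greedy k (k - l) f w -> crossing k l f w D ->
  D (j + 1) = r /\ D (j + 2) = r.
Proof.
move=> Hl Hg Hv HE Hi Hc Hf Hw HD.
have hl : 0 <= l <= k by lia.
have hd : 0 <= k - l by lia.
have [A1 A2 A3 A4 Hy] := inserted_shape hl Hg Hv HE Hi Hc.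
have A5 := A4 (j + 2); have {A5} := A5 ltac:(lia); idx => A5.
have G := greedy_bounds hd Hg Hv; have F := greedy_bounds hd Hf Hw.
have B1 : f (j - 1) = g (j - 1) by apply: A1; lia.
have B2 : f (j - 2) = g (j - 2) by apply: A1; lia.
have W : w (j - 1) = v (j - 1).
  spec G (j - 2); spec G (j - 1); spec G j.
  spec F (j - 2); spec F (j - 1); spec F j; spec F (j + 1).
  lia.
have W' : forall m, m <= j - 1 -> w m = v m.
  by apply: (greedy_agree Hw Hv) => // m Hm; apply: A1; lia.
have DE : D j = E j.
  by apply: (crossing_agree (i := j) HD HE) => [m Hm|m Hm|]; [apply: A1|apply: W'|]; lia.
spec (proj2 HD) j; spec (proj2 HD) (j + 1); spec (proj2 HE) j.
have := W' (j - 2); lia.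
Qed.

(** If i < j are the sites of the two moves, then [j] becomes critical by the
    move at [i], so j is i + 1 or i + 2.  The configuration [g] has one more
    particle at [j] than the common image, which overloads the pair or the
    quadruple at [i], except when the pair at [i] is full and j = i + 2; then
    the quadruples at i + 1 and j overload the pair at i + 3. *)
Lemma right_move_inj k l f g i j : 1 <= l <= k -> admissible k l f -> admissible k l g ->
  last_critical k l f i -> last_critical k l g j ->
  (forall m, right_move f i m = right_move g j m) -> forall m, f m = g m.
Proof.
move=> Hl; wlog Hij : f g i j / i <= j.
  move=> W Hf Hg Hi Hj E m; case: (Z.le_gt_cases i j) => H; first exact: (W f g i j).
  by symmetry; apply: (W g f j i) => //; lia.
move=> Hf Hg [ci Hi] [cj Hj] E.
case: (Z.eq_dec i j) => [Hij2|Hne].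
  by move=> m; have := E m; have := right_moveE f i m; have := right_moveE g j m; lia.
exfalso.
have Q := Hi j ltac:(lia).
have V m : f m = (if Z.eqb m i then 1 else 0) - (if Z.eqb m (i + 1) then 1 else 0)
    + g m - (if Z.eqb m j then 1 else 0) + (if Z.eqb m (j + 1) then 1 else 0).
  have := E m; rewrite /right_move.
  by cases_test; lia.
have [H|[H|H]] : j = i + 1 \/ j = i + 2 \/ j > i + 2 by lia.
- subst j; spec (adm_pair Hg) i; spec (adm_quad Hg) i.
  have := V (i - 1); have := V i; have := V (i + 1); have := V (i + 2).
  cases_test; try lia.
  by unfold critical in ci; lia.
- subst j; spec (adm_pair Hg) i; spec (adm_quad Hg) i; spec (adm_triple Hg) i.
  spec (adm_quad Hg) (i + 1); spec (adm_triple Hg) (i + 2); spec (adm_triple Hg) (i + 1).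
  spec (adm_pair Hf) (i + 3).
  have := V (i - 1); have := V i; have := V (i + 1); have := V (i + 2).
  have := V (i + 3); have := V (i + 4).
  cases_test; try lia.
  move: ci cj Q; rewrite /critical /noncritical; idx; lia.
- have := V (j - 1); have := V j; have := V (j + 1); have := V (j + 2).
  cases_test; try lia.
  move: cj Q; rewrite /critical /noncritical; idx; lia.
Qed.

(** A predecessor [a] of [b] moves at some n <= i, [i] being the cut of [b].
    At n = i it would violate an inequality that is already an equality in the
    definition of the lag at [i].  If n < i, then [i] became critical by the
    move, so [n] is i - 1 or i - 2, and the room that [a] needs at [n] forces
    D_n < D_(n+1); but D is constant from j + 1 to [i].  What remains is n = j,
    i = j + 2, where the pair at [j] is full in [f]: then w_j is at once larger
    than f_(j+2) and at most w_(j+2). *)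
Lemma inserted_no_pred k l f w D r b a j n :
  1 <= l <= k -> admissible k l f -> greedy k (k - l) f w -> crossing k l f w D ->
  last_critical k l f j -> D (j + 1) = r -> D (j + 2) = r ->
  inserted f D r b -> admissible k l a -> last_critical k l a n ->
  (forall m, right_move a n m = b m) -> forall i, D i <= r < D (i + 1) -> False.
Proof.
move=> Hl Hf Hw HD [cj Hj] D1 D2 Hb Ha [cn Hn] E i Hc.
have hl : 0 <= l <= k by lia.
have hd : 0 <= k - l by lia.
have M := crossing_mono hl Hf Hw HD.
have Hij : j + 2 <= i by have := M (i + 1) (j + 2); lia.
have Dr m : j + 1 <= m -> m <= i -> D m = r.
  by move=> m1 m2; have := M (j + 1) m; have := M m i; lia.
have Di := Dr i ltac:(lia) ltac:(lia).
have Q s : i - 1 <= s -> noncritical k l f s by move=> Hs; apply: Hj; lia.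
have [Hb2 [ci Hi]] := inserted_admissible Hl Hf Hw HD Q Hb Hc.
have [A1 A2 A3 A4 Hy] := inserted_shape hl Hf Hw HD Hb Hc.
have A5 := A4 (i + 2); have {A5} := A5 ltac:(lia); idx => A5.
have DD := proj2 HD.
have Hd1 := DD i.
have Hd0 : l - (f (i - 3) + f (i - 2) + f (i - 1) - w (i - 3)) = 0.
  by spec DD (i - 1); have := Dr (i - 1); lia.
have G := greedy_bounds hd Hf Hw.
have V m : a m = b m + (if Z.eqb m n then 1 else 0) - (if Z.eqb m (n + 1) then 1 else 0).
  by have := E m; rewrite /right_move; cases_test; lia.
have B1 : b (i - 1) = f (i - 1) by apply: A1; lia.
have B2 : b (i - 2) = f (i - 2) by apply: A1; lia.
have B3 : b (i - 3) = f (i - 3) by apply: A1; lia.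
have B4 : b (i - 4) = f (i - 4) by apply: A1; lia.
have B5 : b (i - 5) = f (i - 5) by apply: A1; lia.
have B6 : b (i - 6) = f (i - 6) by apply: A1; lia.
have cnb : critical k l b n.
  move: cn; rewrite /critical; have := V n; have := V (n + 1); have := V (n - 1).
  have := V (n + 2); cases_test.
have Hni : n <= i.
  case: (Z.le_gt_cases n i) => // H; have := Hi n ltac:(lia).
  by move: cnb; unfold critical, noncritical; lia.
have [H|[H|[H|H]]] : n = i \/ n < i - 2 \/ n = i - 1 \/ n = i - 2 by lia.
- subst n; spec (adm_pair Ha) (i - 1); spec (adm_quad Ha) (i - 2); spec (adm_quad Ha) (i - 1).
  have := V (i - 1); have := V i; have := V (i + 1); have := V (i - 2); have := V (i - 3).
  cases_test; spec G (i - 2); lia.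
- have := Hn i ltac:(lia); move: ci; rewrite /critical /noncritical.
  have := V (i - 1); have := V i; have := V (i + 1); have := V (i + 2).
  cases_test.
- subst n; spec (adm_pair Ha) (i - 2); spec (adm_quad Ha) (i - 2); spec (adm_quad Ha) (i - 3).
  spec (adm_triple Ha) (i - 3).
  have := V (i - 1); have := V i; have := V (i - 4); have := V (i - 2); have := V (i - 3).
  cases_test; spec G (i - 3); spec G (i - 2); lia.
- subst n; spec (adm_pair Ha) (i - 3); spec (adm_quad Ha) (i - 3); spec (adm_quad Ha) (i - 4).
  spec (adm_triple Ha) (i - 4).
  have H1 : l - (f (i - 4) + f (i - 3) + f (i - 2) - w (i - 4)) > 0.
    have := V (i - 1); have := V i; have := V (i - 4); have := V (i - 2); have := V (i - 3).
    have := V (i - 5); cases_test; spec G (i - 4); spec G (i - 3); lia.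
  have H2 : i = j + 2.
    by spec DD (i - 2); have := Dr (i - 2); have := Dr (i - 1); lia.
  subst i.
  have Qi := Hn (j + 2) ltac:(lia).
  move: Hy Hd1 A2 A3 A5 ci cj cn Qi B1 B2 B3 B4 {Hd0 H1}.
  rewrite /critical /noncritical; idx => Hy Hd1 A2 A3 A5 ci cj cn Qi B1 B2 B3 B4.
  have := V (j + 1); have := V j; have := V (j + 2); have := V (j + 3); have := V (j + 4).
  cases_test; spec G j; spec G (j + 1); spec G (j + 2); lia.
Qed.

(** * The total lag *)

Lemma crossing_exists k l f w : 0 <= l <= k -> admissible k l f -> finite f ->
  greedy k (k - l) f w -> exists D, crossing k l f w D.
Proof.
move=> Hl Ha [B HB] Hw.
have hd : 0 <= k - l by lia.
have G := greedy_bounds hd Ha Hw.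
have h0 m : m < - B -> f (m - 2) + f (m - 1) + f m - w (m - 2) = 0.
  move=> Hm; have := HB (m - 2); have := HB (m - 1); have := HB m.
  by spec G (m - 2); lia.
have [P [PS P0]] := prefix_sum h0.
exists (fun m => l * m - P m); split; last by move=> m; rewrite PS; lia.
by exists (- B) => m Hm; rewrite P0; lia.
Qed.

Lemma greedy_finite k d f w : 0 <= d -> forall l, admissible k l f -> greedy k d f w ->
  forall m, f m = 0 -> w m = 0.
Proof. by move=> Hd l Ha Hw m; have := greedy_bounds Hd Ha Hw m; lia. Qed.

Lemma crossing_limit k l f w D : 0 <= l <= k -> admissible k l f -> finite f ->
  greedy k (k - l) f w -> crossing k l f w D ->
  exists H B, forall m, B <= m -> D m = l * m - H.
Proof.
move=> Hl Ha [B HB] Hw HD.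
have hd : 0 <= k - l by lia.
exists (l * (B + 3) - D (B + 3)), (B + 3).
apply: upward_ind_from => [|m Hm IH]; first lia.
rewrite (proj2 HD) IH (greedy_finite hd Ha Hw); last by apply: HB; lia.
by rewrite !HB; lia.
Qed.

Lemma cut_exists k l f w D rho : 1 <= l <= k -> admissible k l f -> finite f ->
  greedy k (k - l) f w -> crossing k l f w D ->
  exists i, D i <= rho < D (i + 1).
Proof.
move=> Hl Ha Hf Hw HD.
have hl : 0 <= l <= k by lia.
have [H [B HB]] := crossing_limit hl Ha Hf Hw HD.
have [[A HA] _] := HD.
pose m0 := Z.min A (Z.min 0 rho).
have H0 : D m0 <= rho by rewrite HA /m0; nia.
pose m1 := Z.max (Z.max B m0) (Z.max 0 (rho + H + 1)).
have H1 : rho < D m1 by rewrite HB /m1; nia.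
have : m0 <= m1 by lia.
suff S : forall m, m0 <= m -> D m <= rho \/ exists i, D i <= rho < D (i + 1).
  by move=> /S [|//]; lia.
apply: upward_ind_from => [|m Hm [IH|IH]]; [by left| |by right].
by case: (Z.le_gt_cases (D (m + 1)) rho) => ?; [left|right; exists m].
Qed.

Definition total_lag k l f H := exists w D,
  greedy k (k - l) f w /\ crossing k l f w D /\
  exists B, forall m, B <= m -> D m = l * m - H.

Lemma greedy_agree_right k d f w g v i : greedy k d f w -> greedy k d g v ->
  (forall m, i <= m -> f m = g m) -> forall m, i + 1 <= m -> w m = v m.
Proof.
move=> [[A HA] Hw] [[B HB] Hv] Hf.
apply: (downward_ind (B := Z.max A B)) => m Hm; first by rewrite HA ?HB //; lia.
by move=> Hi; rewrite Hw Hv Hm ?Hf; lia.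
Qed.

Lemma crossing_shift k l f w D g v E i c :
  crossing k l f w D -> crossing k l g v E ->
  (forall m, i - 2 <= m -> f m = g m) -> (forall m, i - 2 <= m -> w m = v m) ->
  D i = E i - c -> forall m, i <= m -> D m = E m - c.
Proof.
move=> [_ HD] [_ HE] Hf Hw Hi; apply: upward_ind_from => // m Hm IH.
by rewrite HD HE IH !Hf ?Hw; lia.
Qed.

(** The next two lemmas compare the greedy weights before and after a right move
    at column 0 of the window, [f_1] and [f_2] being the columns -1 and -2 and
    [s] the weight in column 3; the weights agree again in column -1 and their
    sum over the window is unchanged.  Here the pair at 0 is full: then
    w2 <= f2 < f0, and the unit leaving column 0 is either invisible to the
    weights or passes from w0 to w1. *)
Lemma greedy_window_pair k l0 d f_2 f_1 f0 f1 f2 f3 s w2 w1 w0 w_1 v2 v1 v0 v_1 :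
  0 <= d <= k - l0 ->
  f0 + f1 = l0 -> f1 + f2 < l0 -> f_1 + f0 <= l0 -> 0 <= f2 -> 0 <= s <= d ->
  0 <= f_1 -> 0 <= f1 ->
  f_2 + 2 * f_1 + 2 * f0 + f1 <= k + l0 ->
  f0 + 2 * f1 + 2 * f2 + f3 < k + l0 ->
  w2 = Z.min (Z.min f2 (k - (f1 + f2 + f3))) (d - s) ->
  v2 = Z.min (Z.min f2 (k - (f1 + 1 + f2 + f3))) (d - s) ->
  w1 = Z.min (Z.min f1 (k - (f0 + f1 + f2))) (d - w2) ->
  v1 = Z.min (Z.min (f1 + 1) (k - (f0 - 1 + (f1 + 1) + f2))) (d - v2) ->
  w0 = Z.min (Z.min f0 (k - (f_1 + f0 + f1))) (d - w1) ->
  v0 = Z.min (Z.min (f0 - 1) (k - (f_1 + (f0 - 1) + (f1 + 1)))) (d - v1) ->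
  w_1 = Z.min (Z.min f_1 (k - (f_2 + f_1 + f0))) (d - w0) ->
  v_1 = Z.min (Z.min f_1 (k - (f_2 + f_1 + (f0 - 1)))) (d - v0) ->
  w_1 = v_1 /\ w0 + w1 + w2 = v0 + v1 + v2.
Proof.
move=> Hd S0 S1 S_1 p2 ps p_1 p1 L_1 L1 E2 F2 E1 F1 E0 F0 E_1 F_1.
have P : w2 = v2 by clear -E2 F2 L1 S0; lia.
have P' : w2 <= f2 by clear -E2; lia.
rewrite -P in F1 *; clear P F2 E2.
have C : f_1 <= k - (f_2 + f_1 + f0) by clear -L_1 S0 S_1; lia.
have [[q q']|[q q']] : v1 = w1 /\ d - w1 <= f0 - 1 \/ v1 = w1 + 1 /\ w1 = f1.
  by clear -E1 F1 P' S0 S1 Hd; lia.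
  have q0 : v0 = w0 by clear -E0 F0 q q'; lia.
  by clear -E_1 F_1 C q0 q; lia.
have q0 : v0 = w0 - 1 by clear -E0 F0 q q' S0 S_1 Hd; lia.
have q1 : w0 <= d - f1 by clear -E0 q'; lia.
by clear -E_1 F_1 C q0 q q1 S_1 S0; lia.
Qed.

(** Here the quadruple at 0 is full and the pair is not.  With
    q = k - (f_1 + f0 + f1), the caps of the weights in the columns 0 and 1 are q
    and k - l0 - q, before the move and after it, because these numbers do not
    exceed the contents of the two columns. *)
Lemma greedy_window_quad k l0 d f_2 f_1 f0 f1 f2 f3 s w2 w1 w0 w_1 v2 v1 v0 v_1 :
  0 <= d <= k - l0 ->
  f_1 + 2 * f0 + 2 * f1 + f2 = k + l0 ->
  f0 + f1 < l0 -> f1 + f2 < l0 -> f_1 + f0 <= l0 -> 0 <= s <= d ->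
  f_1 + f0 + f1 <= k ->
  f_2 + 2 * f_1 + 2 * f0 + f1 <= k + l0 ->
  f0 + 2 * f1 + 2 * f2 + f3 < k + l0 ->
  w2 = Z.min (Z.min f2 (k - (f1 + f2 + f3))) (d - s) ->
  v2 = Z.min (Z.min f2 (k - (f1 + 1 + f2 + f3))) (d - s) ->
  w1 = Z.min (Z.min f1 (k - (f0 + f1 + f2))) (d - w2) ->
  v1 = Z.min (Z.min (f1 + 1) (k - (f0 - 1 + (f1 + 1) + f2))) (d - v2) ->
  w0 = Z.min (Z.min f0 (k - (f_1 + f0 + f1))) (d - w1) ->
  v0 = Z.min (Z.min (f0 - 1) (k - (f_1 + (f0 - 1) + (f1 + 1)))) (d - v1) ->
  w_1 = Z.min (Z.min f_1 (k - (f_2 + f_1 + f0))) (d - w0) ->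
  v_1 = Z.min (Z.min f_1 (k - (f_2 + f_1 + (f0 - 1)))) (d - v0) ->
  w_1 = v_1 /\ w0 + w1 + w2 = v0 + v1 + v2.
Proof.
move=> Hd L0 S0 S1 S_1 ps T_1 L_1 L1 E2 F2 E1 F1 E0 F0 E_1 F_1.
pose q := k - (f_1 + f0 + f1).
have hq : 0 <= q by rewrite /q; lia.
have {}E0 : w0 = Z.min q (d - w1) by rewrite E0 /q; clear -L0 S1; lia.
have {}F0 : v0 = Z.min q (d - v1) by rewrite F0 /q; clear -L0 S1; lia.
have {}E1 : w1 = Z.min (k - l0 - q) (d - w2).
  by rewrite E1 /q; clear -L0 S_1; lia.
have {}F1 : v1 = Z.min (k - l0 - q) (d - v2).
  by rewrite F1 /q; clear -L0 S_1; lia.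
have C : exists c, k - l0 - q <= c /\ w_1 = Z.min c (d - w0) /\
   exists c', k - l0 - q <= c' /\ v_1 = Z.min c' (d - v0).
  eexists; split; last first.
    split; first exact: E_1.
    by eexists; split; last exact: F_1; rewrite /q; clear -L_1 L0 S0; lia.
  by rewrite /q; clear -L_1 L0 S0; lia.
have P : w2 = v2 /\ w2 <= q \/ q <= w2 /\ q <= v2 by rewrite /q; clear -E2 F2 L1 L0 S0; lia.
clearbody q; clear E_1 F_1 E2 F2 L0 T_1 L_1 L1 S0 S1 S_1.
move: C => [c [hc [E_1 [c' [hc' F_1]]]]].
have [[P1 P2]|[P1 P2]] := P.
  rewrite -P1 in F1 *; have v1w1 : v1 = w1 by lia.
  have v0w0 : v0 = w0 by lia.
  have : d - w0 <= k - l0 - q by clear -E0 E1 P2 Hd; lia.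
  by clear -hc hc' E_1 F_1 v0w0 v1w1; lia.
have w1E : w1 = d - w2 by clear -E1 P1 Hd; lia.
have v1E : v1 = d - v2 by clear -F1 P2 Hd; lia.
have w0E : w0 = q by clear -E0 w1E P1; lia.
have v0E : v0 = q by clear -F0 v1E P2; lia.
by clear -hc hc' E_1 F_1 w1E v1E w0E v0E Hd; lia.
Qed.

(** The move shifts a particle, and the greedy weights at most within three
    columns; so the thresholds agree on the left of the move and, the sum of
    the lags being preserved, on the right of it. *)
Lemma crossing_right_move k l l0 f w D i g v E :
  1 <= l0 <= l -> l <= k -> admissible k l0 f -> last_critical k l0 f i ->
  (forall m, g m = right_move f i m) -> admissible k l0 g ->
  greedy k (k - l) f w -> crossing k l f w D ->
  greedy k (k - l) g v -> crossing k l g v E ->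
  exists B, forall m, B <= m -> D m = E m.
Proof.
move=> Hl Hlk Hf [ci Hi] Hg Ag Hw HD Hv HE.
have hd : 0 <= k - l by lia.
have Gm m : (m = i -> g m = f m - 1) /\ (m = i + 1 -> g m = f m + 1) /\
  (m <> i -> m <> i + 1 -> g m = f m).
  by rewrite Hg; apply: right_moveE.
have R : forall m, i + 3 <= m -> w m = v m.
  move=> m Hm; apply: (greedy_agree_right (i := i + 2) Hw Hv); last by lia.
  by move=> n Hn; have := Gm n; lia.
have [W1 W2] : w (i - 1) = v (i - 1) /\
    w i + w (i + 1) + w (i + 2) = v i + v (i + 1) + v (i + 2).
  have := Gm (i - 2); have := Gm (i - 1); have := Gm i; have := Gm (i + 1).
  have := Gm (i + 2); have := Gm (i + 3) => g3 g2 g1 g0 gm1 gm2.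
  have e_2 : g (i - 2) = f (i - 2) by lia.
  have e_1 : g (i - 1) = f (i - 1) by lia.
  have e0 : g i = f i - 1 by lia.
  have e1 : g (i + 1) = f (i + 1) + 1 by lia.
  have e2 : g (i + 2) = f (i + 2) by lia.
  have e3 : g (i + 3) = f (i + 3) by lia.
  have r3 := R (i + 3) ltac:(lia).
  have Ew m : w m = Z.min (Z.min (f m) (k - (f (m - 1) + f m + f (m + 1))))
    (k - l - w (m + 1)) by apply: (proj2 Hw).
  have Ev m : v m = Z.min (Z.min (g m) (k - (g (m - 1) + g m + g (m + 1))))
    (k - l - v (m + 1)) by apply: (proj2 Hv).
  have G := greedy_bounds hd (admissible_mono (proj2 Hl) Hf) Hw.
  have rb : 0 <= w (i + 3) <= k - l by have := G (i + 3); have := G (i + 4); idx; lia.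
  have d0 : 0 <= k - l <= k - l0 by lia.
  have H0 := adm_ge0 Hf; spec (adm_triple Hf) (i - 1).
  have := Hi (i + 1); have := Hi (i + 2); rewrite /noncritical; idx => q2 q1.
  spec (adm_pair Hf) (i - 1); spec (adm_quad Hf) (i - 1).
  spec (adm_pair Hf) i; spec (adm_quad Hf) i.
  have [S|S] : f i + f (i + 1) = l0 \/ f i + f (i + 1) < l0 by lia.
    apply: (greedy_window_pair (k := k) (l0 := l0) (d := k - l) (f_2 := f (i - 2))
      (f_1 := f (i - 1)) (f2 := f (i + 2)) (f3 := f (i + 3)) _ S _ _ _ rb);
      try exact: H0; first
      [by rewrite {1}Ew; idx|by rewrite {1}Ev; idx; rewrite ?e_2 ?e_1 ?e0 ?e1 ?e2 ?e3 ?r3|lia].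
  have {}ci : f (i - 1) + 2 * f i + 2 * f (i + 1) + f (i + 2) = k + l0.
    by unfold critical in ci; lia.
  apply: (greedy_window_quad (k := k) (l0 := l0) (d := k - l) (f_2 := f (i - 2))
     (f3 := f (i + 3)) _ ci _ _ _ rb); first
      [by rewrite {1}Ew; idx|by rewrite {1}Ev; idx; rewrite ?e_2 ?e_1 ?e0 ?e1 ?e2 ?e3 ?r3|lia].
have L : forall m, m <= i - 1 -> w m = v m.
  by apply: (greedy_agree Hw Hv) => // m Hm; have := Gm m; lia.
have Di : D i = E i.
  apply: (crossing_agree (i := i) HD HE) => [m Hm|m Hm|]; last lia.
  - by have := Gm m; lia.
  - by apply: L; lia.
exists (i + 5) => m Hm.
have := crossing_shift (i := i + 5) (c := 0) HD HE.
have S m' : i + 2 <= m' -> f m' = g m' by have := Gm m'; lia.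
have := proj2 HD i; have := proj2 HE i.
spec (proj2 HD) (i + 1); spec (proj2 HE) (i + 1).
spec (proj2 HD) (i + 2); spec (proj2 HE) (i + 2).
spec (proj2 HD) (i + 3); spec (proj2 HE) (i + 3).
spec (proj2 HD) (i + 4); spec (proj2 HE) (i + 4).
have := Gm (i - 2); have := Gm (i - 1); have := Gm i; have := Gm (i + 1).
have := Gm (i + 2); have := Gm (i + 3); have := Gm (i + 4); have := L (i - 2).
move=> ? ? ? ? ? ? ? ? ? ? C.
have := C ltac:(move=> n Hn; apply: S; lia) ltac:(move=> n Hn; apply: R; lia) ltac:(lia) m Hm.
lia.
Qed.

(** A separated particle of weight [l0] at the far right delays the
    [l]-particle by 3 l0 - min (l0, k - l), as its greedy weights add up to
    min (l0, k - l). *)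
Lemma crossing_free k l l0 f w D i g v E :
  0 <= l0 <= l -> l <= k -> admissible k l f ->
  f i + f (i + 1) = l0 -> (forall m, i + 2 <= m -> f m = 0) -> f (i - 1) = 0 ->
  (forall m, m < i -> g m = f m) -> (forall m, i <= m -> g m = 0) ->
  admissible k l g ->
  greedy k (k - l) f w -> crossing k l f w D ->
  greedy k (k - l) g v -> crossing k l g v E ->
  exists B, forall m, B <= m ->
    D m = E m - (2 * l0 + Z.max (l + l0 - k) 0).
Proof.
move=> Hl Hlk Ha S0 Z0 Z1 gl gr Ag Hw HD Hv HE.
have hd : 0 <= k - l by lia.
have wz := greedy_finite hd Ha Hw; have vz := greedy_finite hd Ag Hv.
have Zf m : i + 2 <= m -> f m = 0 /\ w m = 0 /\ g m = 0 /\ v m = 0.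
  by move=> Hm; rewrite wz ?vz ?Z0 ?gr //; lia.
have g1 : g (i - 1) = 0 by rewrite gl //; lia.
have w1 := wz _ Z1; have v1 := vz _ g1.
have v2 := vz _ (gr i ltac:(lia)); have v3 := vz _ (gr (i + 1) ltac:(lia)).
have W : w i + w (i + 1) = Z.min l0 (k - l).
  have H0 := adm_ge0 Ha.
  have := proj2 Hw i; have := proj2 Hw (i + 1); idx.
  have [-> [-> _]] := Zf (i + 2) ltac:(lia); rewrite Z1.
  by have := H0 i; have := H0 (i + 1); clear -S0 Hl Hlk; lia.
have L : forall m, m <= i - 1 -> w m = v m.
  by apply: (greedy_agree Hw Hv); [move=> m Hm; rewrite gl //; lia|lia].
have Di : D i = E i.
  apply: (crossing_agree (i := i) HD HE) => [m Hm|m Hm|]; last lia.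
  - by rewrite gl.
  - by apply: L; lia.
exists (i + 5); apply: (crossing_shift HD HE).
- by move=> m Hm; have := Zf m; lia.
- by move=> m Hm; have := Zf m; lia.
have := proj2 HD i; have := proj2 HE i.
spec (proj2 HD) (i + 1); spec (proj2 HE) (i + 1).
spec (proj2 HD) (i + 2); spec (proj2 HE) (i + 2).
spec (proj2 HD) (i + 3); spec (proj2 HE) (i + 3).
spec (proj2 HD) (i + 4); spec (proj2 HE) (i + 4).
have := Zf (i + 2); have := Zf (i + 3); have := Zf (i + 4).
have := L (i - 2); have := gl (i - 2); have := gr i; have := gr (i + 1).
lia.
Qed.

Lemma total_lag_exists k l f : 0 <= l <= k -> admissible k l f -> finite f ->
  exists w D H, greedy k (k - l) f w /\ crossing k l f w D /\
    exists B, forall m, B <= m -> D m = l * m - H.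
Proof.
move=> Hl Ha Hf.
have [w Hw] := greedy_exists (d := k - l) ltac:(lia) Ha Hf.
have [D HD] := crossing_exists Hl Ha Hf Hw.
have [H [B HB]] := crossing_limit Hl Ha Hf Hw HD.
by exists w, D, H; do 2 split => //; exists B.
Qed.

(** * Orbits of right moves *)

(* From here on [lia] also has to read the arithmetic of step counts. *)
From mathcomp Require Import zify ssrZ.

Lemma right_move_admissible k l f i : 1 <= l <= k -> admissible k l f ->
  last_critical k l f i -> admissible k l (right_move f i).
Proof.
move=> Hl Ha [ci Hi].
have := Hi (i + 1) ltac:(lia); have := Hi (i + 2) ltac:(lia).
move: ci; rewrite /critical /noncritical; idx => ci q2 q1.
have H0 := adm_ge0 Ha; have HT := adm_triple Ha.
have p : 1 <= f i.
  by have := H0 i; have := H0 (i + 2); spec HT (i - 1); lia.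
have V m : right_move f i m = f m - (if Z.eqb m i then 1 else 0) + (if Z.eqb m (i + 1) then 1 else 0).
  by rewrite /right_move; cases_test; lia.
split=> m; rewrite !V.
- by case: (Z.eq_dec m i) => [->|Hne]; [|have := H0 m]; cases_test.
- case: (Z.eq_dec m (i + 1)) => [->|Hne]; last by spec HT m; cases_test.
  spec HT (i - 1); spec HT i; have := H0 (i + 2); idx; cases_test.
- case: (Z.eq_dec m (i + 1)) => [->|Hne]; last by spec (adm_pair Ha) m; cases_test.
  by idx; cases_test.
- case: (Z.eq_dec m (i + 1)) => [->|Hne]; first by idx; cases_test.
  case: (Z.eq_dec m (i + 2)) => [->|Hne2]; first by idx; cases_test.
  by spec (adm_quad Ha) m; cases_test.
Qed.


Lemma last_critical_exists k l f i : 1 <= l <= k -> admissible k l f -> finite f ->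
  critical k l f i -> exists j, i <= j /\ last_critical k l f j.
Proof.
move=> Hl Ha [B HB] Hi.
suff [H|//] : (forall j, i <= j -> noncritical k l f j) \/
    exists j, i <= j /\ last_critical k l f j.
  by have := H i; move: Hi; rewrite /critical /noncritical; lia.
move: i {Hi}; apply: (downward_ind (B := B + 2)) => m Hm.
  by left=> j Hj; rewrite /noncritical !HB; lia.
case: Hm => [H|[j [Hj Hlj]]]; last by right; exists j; split=> //; lia.
have [C|C] : critical k l f m \/ noncritical k l f m.
- by rewrite /critical /noncritical; have := adm_pair Ha m; have := adm_quad Ha m; lia.
- by right; exists m; split; [lia|split=> // j Hj; apply: H; lia].
- left=> j Hj; case: (Z.eq_dec j m) => [->//|Hne]; apply: H; lia.
Qed.

Lemma right_move_critical k l f i : critical k l f i -> critical k l (right_move f i) i.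
Proof.
rewrite /critical; have := right_moveE f i i; have := right_moveE f i (i + 1).
have := right_moveE f i (i - 1); have := right_moveE f i (i + 2); lia.
Qed.

Definition free_particle (l : Z) (f : Z -> Z) (i : Z) : Prop :=
  f i + f (i + 1) = l /\ f i <> 0 /\ forall j, i + 2 <= j -> f j = 0.

(** A full quadruple at [i] whose last column is empty forces a full pair, its
    first three columns adding up to at most [k]. *)
Lemma last_critical_free k l f i : 1 <= l <= k -> admissible k l f ->
  last_critical k l f i -> (forall m, i + 2 <= m -> f m = 0) ->
  free_particle l f i.
Proof.
move=> Hl Ha [ci Hi] Z0.
spec (adm_triple Ha) (i - 1); have := adm_pair Ha i; spec Hi (i + 1).
have := Z0 (i + 2); move: ci X0; rewrite /critical /noncritical /free_particle; idx => ci q z s.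
by have h := adm_ge0 Ha (i + 2); split; [lia|split; [lia|exact: Z0]].
Qed.

Lemma free_last_critical k l f i : 1 <= l <= k -> admissible k l f ->
  free_particle l f i -> last_critical k l f i.
Proof.
move=> Hl Ha [S0 [ni Z0]]; split; first by left.
have H0 := adm_ge0 Ha; have h0 := H0 i; have h1 := H0 (i + 1).
have z2 := Z0 (i + 2) ltac:(lia); have z3 := Z0 (i + 3) ltac:(lia).
have z4 := Z0 (i + 4) ltac:(lia).
move=> j Hj; rewrite /noncritical.
have [H|[H|H]] : j = i + 1 \/ j = i + 2 \/ j > i + 2 by lia.
- subst j; idx; lia.
- subst j; idx; lia.
- by rewrite !Z0; lia.
Qed.

Definition left_of (f : Z -> Z) (i : Z) : Z -> Z :=
  fun m => if Z.ltb m i then f m else 0.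

Lemma left_ofE f i m : (m < i -> left_of f i m = f m) /\ (i <= m -> left_of f i m = 0).
Proof. by rewrite /left_of; case: (Z.ltb_spec m i); lia. Qed.

(** The quantity (i + 1) l - f_i is the energy i f_i + (i + 1) f_(i+1) of the
    free particle. *)
Lemma free_right_move k l f i : 1 <= l <= k -> admissible k l f -> free_particle l f i ->
  exists j, i <= j /\ free_particle l (right_move f i) j /\
    left_of (right_move f i) j = left_of f i /\
    (j + 1) * l - right_move f i j = (i + 1) * l - f i + 1.
Proof.
move=> Hl Ha [S0 [ni Z0]]; have h0 := adm_ge0 Ha i.
have z2 := Z0 (i + 2) ltac:(lia).
have V := right_moveE f i.
have [H|H] : f i > 1 \/ f i = 1 by lia.
- exists i; split; first lia; split; [split; [|split]|split].
  + by have := V i; have := V (i + 1); lia.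
  + by have := V i; lia.
  + by move=> j Hj; have := V j; have := Z0 j; lia.
  + apply: functional_extensionality => m.
    by have := V m; have := left_ofE f i m; have := left_ofE (right_move f i) i m; lia.
  + by have := V i; lia.
- exists (i + 1); split; first lia; split; [split; [|split]|split].
  + by idx; have := V (i + 2); have := V (i + 1); lia.
  + by have := V (i + 1); lia.
  + by move=> j Hj; have := V j; have := Z0 j; lia.
  + apply: functional_extensionality => m; have := V i.
    have := V m; have := left_ofE f i m; have := left_ofE (right_move f i) (i + 1) m.
    by case: (Z.eq_dec m i) => [->|]; lia.
  + by have := V (i + 1); lia.
Qed.

Definition evolution k l (F : nat -> Z -> Z) (I : nat -> Z) : Prop :=
  forall t, admissible k l (F t) /\ last_critical k l (F t) (I t) /\
    F (S t) = right_move (F t) (I t).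

Lemma potential_ge0 (f tau : Z -> Z) A : (forall m, 0 <= f m) ->
  (forall m, tau (m + 1) = 2 * tau m - tau (m - 1) + f m) ->
  (forall m, m <= A -> tau m = 0) -> forall m, 0 <= tau m.
Proof.
move=> H0 Ht HA m; case: (Z.le_gt_cases m A) => Hm; first by rewrite HA //; lia.
suff: 0 <= tau m /\ tau (m - 1) <= tau m by lia.
have {}Hm : A <= m by lia.
move: m Hm; apply: upward_ind_from => [|m Hm IH]; first by rewrite !HA; lia.
by idx; have := Ht m; have := H0 m; lia.
Qed.

(** The sum of (R - m) f_m over m < R drops by one at each move on the left of
    [R] and stays non-negative, so some move takes place at [R] or beyond; the
    first such move finds nothing on the right of its two columns. *)
Lemma evolution_free k l F I R : 1 <= l <= k -> evolution k l F I ->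
  finite (F O) -> (forall m, R + 1 <= m -> F O m = 0) ->
  exists t, free_particle l (F t) (I t).
Proof.
move=> Hl HE [B HB].
have [N [NS N0]] := @prefix_sum (F O) (- B) ltac:(by move=> m Hm; apply: HB; lia).
have [T [TS T0]] := @prefix_sum N (- B) ltac:(by move=> m Hm; apply: N0; lia).
(* [tau m] is the sum of (m - j) f_j over j < m, a double prefix sum *)
have [tau Etau] : exists tau, forall m, tau m = T (m + 1) by exists (fun m => T (m + 1)).
have Ht m : tau (m + 1) = 2 * tau m - tau (m - 1) + F O m.
  by rewrite !Etau; idx; spec TS (m + 1); have := NS m; have := TS m; lia.
have HA : exists A, forall m, m <= A -> tau m = 0.
  by exists (- B - 1) => m Hm; rewrite Etau T0; lia.
have [n Hn] : exists n, tau R <= Z.of_nat n by exists (Z.to_nat (tau R)); lia.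
move: HA Hn Ht HE {B HB N NS N0 T TS T0 Etau}.
elim: n F I tau => [|n IH] F I tau [A HA] Hn Ht HE HR.
all: have [Ha [Hc HF]] := HE O.
all: case: (Z.le_gt_cases R (I O)) => HI;
  first by exists O; apply: (last_critical_free Hl Ha Hc) => m Hm; apply: HR; lia.
all: have [Ha1 _] := HE 1%nat; have V := right_moveE (F O) (I O).
all: have [tau' Et] : exists tau', forall m, tau' m = tau m - (if Z.ltb (I O) m then 1 else 0)
  by exists (fun m => tau m - (if Z.ltb (I O) m then 1 else 0)).
all: have Ht1 m : tau' (m + 1) = 2 * tau' m - tau' (m - 1) + F 1%nat m
    by rewrite !Et Ht HF; move: (V m) => {}V; case: (Z.ltb_spec (I O) (m + 1));
       case: (Z.ltb_spec (I O) m); case: (Z.ltb_spec (I O) (m - 1)); lia.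
all: have A1 : exists A, forall m, m <= A -> tau' m = 0
  by exists (Z.min A (I O)) => m Hm; rewrite Et HA; case: (Z.ltb_spec (I O) m); lia.
all: have R1 : tau' R = tau R - 1 by rewrite Et; case: (Z.ltb_spec (I O) R); lia.
  have [A' HA'] := A1.
  by have := @potential_ge0 _ _ _ (adm_ge0 Ha1) Ht1 HA' R; lia.
have [||m Hm|t Ht'] := IH (fun t => F (S t)) (fun t => I (S t)) tau' A1 _ Ht1.
- by lia.
- by move=> t; have := HE (S t).
- rewrite HF; have := V m; have := HR m; lia.
by exists (S t).
Qed.

Lemma evolution_stays_free k l F I t s : 1 <= l <= k -> evolution k l F I ->
  free_particle l (F t) (I t) ->
  free_particle l (F (t + s)%nat) (I (t + s)%nat) /\
  left_of (F (t + s)%nat) (I (t + s)%nat) = left_of (F t) (I t) /\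
  (I (t + s)%nat + 1) * l - F (t + s)%nat (I (t + s)%nat) =
  (I t + 1) * l - F t (I t) + Z.of_nat s.
Proof.
move=> Hl HE Hf; elim: s => [|s [IH1 [IH2 IH3]]].
  by rewrite addn0; do 2 split => //; lia.
rewrite addnS; have [Ha [Hc HF]] := HE (t + s)%nat.
have [j [_ [J1 [J2 J3]]]] := free_right_move Hl Ha IH1.
have [Ha1 [Hc1 _]] := HE (S (t + s)).
rewrite -HF in J1 J2 J3.
have -> : I (S (t + s)) = j.
  exact: last_critical_uniq Hc1 (free_last_critical Hl Ha1 J1).
by rewrite J2 J3 IH2 IH3; do 2 split => //; lia.
Qed.

(** * Configurations assembled from a list of particles *)

(** Rigged partitions are encoded as lists of pairs (weight, rigging), heaviest
    particle first. *)
Definition may_precede (l rho : Z) (x : list (Z * Z)) : Prop :=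
  match x with
  | nil => True
  | cons (l', rho') _ => l' < l \/ l' = l /\ rho' <= rho
  end.

Inductive assembled (k : Z) : (Z -> Z) -> list (Z * Z) -> Prop :=
| assembled_nil : assembled k (fun _ => 0) nil
| assembled_cons f x l rho w D a :
    assembled k f x -> 1 <= l <= k -> may_precede l rho x ->
    greedy k (k - l) f w -> crossing k l f w D -> inserted f D rho a ->
    assembled k a (cons (l, rho) x).

Lemma admissible_zero k l : 0 <= l <= k -> admissible k l (fun _ => 0).
Proof. by move=> Hl; split=> i; lia. Qed.

Lemma inserted_finite k l f w D rho a : 1 <= l <= k -> admissible k l f -> finite f ->
  greedy k (k - l) f w -> crossing k l f w D -> inserted f D rho a -> finite a.
Proof.
move=> Hl Ha Hf Hw HD Hi.
have hl : 0 <= l <= k by lia.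
have [H [B HB]] := crossing_limit hl Ha Hf Hw HD.
have [[A HA] _] := HD; have [C HC] := Hf.
exists (Z.abs A + Z.abs B + Z.abs C + Z.abs H + Z.abs rho + 1) => m Hm.
rewrite Hi HC; last lia.
have [Hm1|Hm1] : m <= A - 1 /\ m < rho - 1 /\ m < - 1 \/
    B + 1 <= m /\ rho + H + 1 < m /\ 1 < m by lia.
- have : l * (m + 1) <= m + 1 by nia.
  by rewrite !HA; lia.
- have : m - 1 <= l * (m - 1) by nia.
  by rewrite !HB; lia.
Qed.

(** The invariant of [assembled] that makes further insertions possible: a new
    particle of the same weight has its cut at [j + 2] or further iff its
    rigging is at least [r], and then everything from the site before the cut
    on is noncritical. *)
Definition head_at_threshold (k : Z) (f : Z -> Z) (x : list (Z * Z)) : Prop :=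
  finite f /\
  match x with
  | nil => f = fun _ => 0
  | cons (l, r) _ => 1 <= l <= k /\ admissible k l f /\ exists j,
      last_critical k l f j /\
      forall w D, greedy k (k - l) f w -> crossing k l f w D ->
        D (j + 1) = r /\ D (j + 2) = r
  end.

Lemma head_admissible k f x l rho : head_at_threshold k f x -> 1 <= l <= k ->
  may_precede l rho x -> admissible k l f.
Proof.
case: x => [|[l' r] x] [_] => [->|[Hl' [Ha _]]] Hl Hx; first by apply: admissible_zero; lia.
by apply: admissible_mono Ha; move: Hx => /=; lia.
Qed.

Lemma insert_above_head k f x l rho w D a i : head_at_threshold k f x -> 1 <= l <= k ->
  may_precede l rho x -> greedy k (k - l) f w -> crossing k l f w D ->
  inserted f D rho a -> D i <= rho < D (i + 1) ->
  admissible k l a /\ last_critical k l a i.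
Proof.
move=> Ht Hl Hx Hw HD Hi Hc.
have Ha := head_admissible Ht Hl Hx.
apply: (inserted_admissible Hl Ha Hw HD _ Hi Hc) => s Hs.
case: x Ht Hx => [|[l' r] x] [_] => [->|[Hl' [Ha' [j [[_ Hj] Hr]]]]] /= Hx.
  by rewrite /noncritical; lia.
have [H|[Hll Hrr]] := Hx; first exact: (admissible_noncritical _ H Ha').
subst l'; have [D1 D2] := Hr _ _ Hw HD.
apply: Hj; have hl : 0 <= l <= k by lia.
by have := crossing_mono hl Ha Hw HD (m := i + 1) (n := j + 2); lia.
Qed.

Lemma assembled_head k f x : assembled k f x -> head_at_threshold k f x.
Proof.
elim=> {f x} [|f x l rho w D a Hf IH Hl Hx Hw HD Hi].
  split; [by exists 0|by []].
have Ha := head_admissible IH Hl Hx.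
have [Hfin _] := IH.
split; first exact: (inserted_finite Hl Ha Hfin Hw HD Hi).
have [i Hc] := cut_exists rho Hl Ha Hfin Hw HD.
have [Haa Hla] := insert_above_head IH Hl Hx Hw HD Hi Hc.
split=> //; split=> //; exists i; split=> // w' D' Hw' HD'.
exact: (crossing_of_inserted Hl Ha Hw HD Hi Hc Haa Hw' HD').
Qed.

Lemma inserted_exists f D rho : exists a, inserted f D rho a.
Proof. by eexists=> m; reflexivity. Qed.

Lemma assembled_exists_cons k f x l rho : assembled k f x -> 1 <= l <= k ->
  may_precede l rho x -> exists a, assembled k a (cons (l, rho) x).
Proof.
move=> Hf Hl Hx; have Ht := assembled_head Hf.
have Ha := head_admissible Ht Hl Hx.
have hl : 0 <= l <= k by lia.
have [w [D [H [Hw [HD _]]]]] := total_lag_exists hl Ha (proj1 Ht).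
have [a Hi] := inserted_exists f D rho.
by exists a; exact: (assembled_cons Hf Hl Hx Hw HD Hi).
Qed.

(** One step back along an orbit.  If the rigging can still be lowered,
    injectivity of the right move identifies [a]; if not, there is no [a]. *)
Lemma assembled_back k f x l rho w D b a n : assembled k f x -> 1 <= l <= k ->
  may_precede l (rho + 1) x -> greedy k (k - l) f w -> crossing k l f w D ->
  inserted f D (rho + 1) b -> admissible k l a -> last_critical k l a n ->
  right_move a n = b -> may_precede l rho x /\ inserted f D rho a.
Proof.
move=> Hf Hl Hx Hw HD Hb Ha Hn E; have Ht := assembled_head Hf.
have Haf := head_admissible Ht Hl Hx; have [Hfin _] := Ht.
have [Hx'|Hx'] : may_precede l rho x \/ exists r x', x = cons (l, r) x' /\ r = rho + 1.
- case: x Hx {Hf Ht} => [|[l' r] x] /=; first by left.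
  move=> [H|[H1 H2]]; first by left; left.
  case: (Z.le_gt_cases r rho) => H; first by left; right.
  by right; exists r, x; rewrite H1; split=> //; lia.
- split=> //; have [a' Hi] := inserted_exists f D rho.
  have [i Hc] := cut_exists rho Hl Haf Hfin Hw HD.
  have [Haa' Hla'] := insert_above_head Ht Hl Hx' Hw HD Hi Hc.
  have hl : 0 <= l <= k by lia.
  have Hs := inserted_step hl Haf Hw HD Hi Hc.
  have : forall m, a m = a' m.
    by apply: (right_move_inj Hl Ha Haa' Hn Hla') => m; rewrite E Hb Hs.
  by move=> Eaa m; rewrite Eaa.
(* Here rho + 1 is the smallest allowed rigging. *)
- exfalso; move: Hx' Ht => [r [x' [-> Hr]]] [_ [_ [_ [j [Hj HDj]]]]].
  have [D1 D2] := HDj _ _ Hw HD.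
  have [i Hc] := cut_exists r Hl Haf Hfin Hw HD.
  rewrite -Hr in Hb.
  by apply: (inserted_no_pred Hl Haf Hw HD Hj D1 D2 Hb Ha Hn _ Hc) => m; rewrite E.
Qed.

Lemma evolution_back k f x l rho w D F I t : assembled k f x -> 1 <= l <= k ->
  greedy k (k - l) f w -> crossing k l f w D -> evolution k l F I ->
  may_precede l (rho + Z.of_nat t) x -> inserted f D (rho + Z.of_nat t) (F t) ->
  may_precede l rho x /\ inserted f D rho (F O).
Proof.
move=> Hf Hl Hw HD HE; elim: t => [|t IH]; first by rewrite Z.add_0_r.
have -> : rho + Z.of_nat (S t) = rho + Z.of_nat t + 1 by lia.
move=> Hx Hi; have [Ha [Hn E]] := HE t.
have [Hx' Hi'] := assembled_back Hf Hl Hx Hw HD Hi Ha Hn (esym E).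
exact: IH.
Qed.

(** Far to the right the thresholds are l m - H, and there insertion means
    putting down a free particle; its energy is [rho + H]. *)
Lemma free_inserted k l g w D H : 1 <= l <= k -> admissible k l g ->
  greedy k (k - l) g w -> crossing k l g w D ->
  (exists B, forall m, B <= m -> D m = l * m - H) ->
  exists M, forall i a, M <= i -> admissible k l a -> free_particle l a i ->
    left_of a i = g -> inserted g D ((i + 1) * l - a i - H) a.
Proof.
move=> Hl Ha Hw HD [B HB]; exists B => i a Hi Haa [S0 [ni Z0]] Eg m.
have hl : 0 <= l <= k by lia.
have M := crossing_mono hl Ha Hw HD.
have ai := adm_ge0 Haa i; have ai1 := adm_ge0 Haa (i + 1).
have E := left_ofE a i m; rewrite Eg in E.
have Di := HB i Hi; have Di1 := HB (i + 1) ltac:(lia).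
have [Hm|[Hm|[Hm|Hm]]] : m < i \/ m = i \/ m = i + 1 \/ i + 2 <= m by lia.
- have := M (m + 1) i; have := M m i; have := M (m - 1) i; lia.
- subst m; have := M (i - 1) i; lia.
- subst m; have := HB (i + 2); idx; lia.
- have := HB (m + 1); have := HB m; have := HB (m - 1); have := Z0 m.
  have : l * (m - 1) >= l * (i + 1) by nia.
  lia.
Qed.

Lemma inserted_far k l g w D H : 1 <= l <= k -> admissible k l g -> finite g ->
  greedy k (k - l) g w -> crossing k l g w D ->
  (exists B, forall m, B <= m -> D m = l * m - H) ->
  exists R, forall rho a, R <= rho -> inserted g D rho a ->
    exists i, [/\ free_particle l a i, left_of a i = g, a (i - 1) = 0 &
      (i + 1) * l - a i = rho + H].
Proof.
move=> Hl Ha Hf Hw HD [B HB].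
have hl : 0 <= l <= k by lia.
have hd : 0 <= k - l by lia.
have [C HC] := Hf.
have M := crossing_mono hl Ha Hw HD.
have wz := greedy_finite hd Ha Hw.
pose K := Z.max B (C + 4); exists (D K) => rho a Hr Hi.
have [i Hc] := cut_exists rho Hl Ha Hf Hw HD.
have KI : K <= i by have := M (i + 1) K; lia.
have Zg m : i - 3 <= m -> g m = 0 by move=> Hm; apply: HC; lia.
have Zw m : i - 3 <= m -> w m = 0 by move=> Hm; apply: wz; apply: Zg.
have [A1 A2 A3 A4 Hy] := inserted_shape hl Ha Hw HD Hi Hc.
have Z1 := Zg (i - 1) ltac:(lia); have Z2 := Zg i ltac:(lia).
have Z3 := Zg (i + 1) ltac:(lia); have W1 := Zw (i - 1) ltac:(lia).
exists i; split.
- split; first lia; split; first lia.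
  by move=> j Hj; rewrite A4 // Zg ?Zw; lia.
- apply: functional_extensionality => m; have := left_ofE a i m.
  by have := A1 m; have := Zg m; lia.
- by rewrite A1; lia.
- by rewrite A2 Z2; have := HB (i + 1); lia.
Qed.

Definition pair_lag (k l l' : Z) : Z := 2 * Z.min l l' + Z.max (l + l' - k) 0.

Fixpoint lag_sum (k l : Z) (x : list (Z * Z)) : Z :=
  match x with
  | nil => 0
  | cons (l', _) x' => pair_lag k l l' + lag_sum k l x'
  end.

Lemma assembled_le k f x l : assembled k f x -> admissible k l f ->
  match x with nil => True | cons (l', _) _ => l' <= l end.
Proof.
move=> /assembled_head; case: x => [//|[l' r] x] [_ [_ [_ [j [[cj _] _]]]]] Ha.
by have := adm_pair Ha j; have := adm_quad Ha j; move: cj; rewrite /critical; lia.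
Qed.

(** All insertions into [g] at larger riggings lie on the orbit of the first
    one, hence have the same total lag. *)
Lemma total_lag_inserted k l l0 g x rho w D n a0 a H :
  1 <= l0 <= l -> l <= k -> assembled k g x -> may_precede l0 rho x ->
  greedy k (k - l0) g w -> crossing k l0 g w D -> inserted g D rho a0 ->
  inserted g D (rho + Z.of_nat n) a -> total_lag k l a0 H -> total_lag k l a H.
Proof.
move=> Hl0 Hlk Hg Hx Hw HD Hi.
have Hl : 1 <= l0 <= k by lia.
have hl : 0 <= l0 <= k by lia.
have Ht := assembled_head Hg.
have Hx' t : may_precede l0 (rho + Z.of_nat t) x.
  by case: x Hx {Hg Ht} => [//|[l' r] x] /=; lia.
have Hag := head_admissible Ht Hl Hx.
elim: n a => [|n IH] a.
  rewrite Z.add_0_r => Hia; have -> // : a = a0.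
  by apply: functional_extensionality => m; rewrite Hia Hi.
move=> Hia HL; have [b Hb] := inserted_exists g D (rho + Z.of_nat n).
have [v [E [Hv [HE [B HB]]]]] := IH b Hb HL.
have [i Hc] := cut_exists (rho + Z.of_nat n) Hl Hag (proj1 Ht) Hw HD.
have [Hab Hlb] := insert_above_head Ht Hl (Hx' n) Hw HD Hb Hc.
have Hs := inserted_step hl Hag Hw HD Hb Hc.
have Eab m : a m = right_move b i m.
  by rewrite Hia Hs; have -> : rho + Z.of_nat (S n) = rho + Z.of_nat n + 1 by lia.
have Ha : admissible k l0 a.
  by have -> : a = right_move b i; [exact: functional_extensionality|exact: right_move_admissible].
have Hfa := inserted_finite Hl Hag (proj1 Ht) Hw HD Hia.
have hl' : 0 <= l <= k by lia.
have [v' [E' [H' [Hv' [HE' _]]]]] := total_lag_exists hl' (admissible_mono (proj2 Hl0) Ha) Hfa.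
have [B' HB'] := crossing_right_move Hl0 Hlk Hab Hlb Eab Ha Hv HE Hv' HE'.
exists v', E'; do 2 split => //; exists (Z.max B B') => m Hm.
by rewrite -HB' ?HB; lia.
Qed.

(** Push the first particle out to infinity, where it contributes its pair lag
    and leaves the rest of the list. *)
Lemma assembled_lag k f x l H : assembled k f x -> 1 <= l <= k -> admissible k l f ->
  total_lag k l f H -> H = lag_sum k l x.
Proof.
move=> Hf Hl; elim: Hf H => {f x} [H|f x l0 rho w D a Hf IH Hl0 Hx Hw HD Hi H] Ha.
  move=> [w [D [Hw [HD [B HB]]]]] /=; have hd : 0 <= k - l by lia.
  have wz m : w m = 0 by exact: (greedy_finite hd Ha Hw).
  have [[A HA] HS] := HD.
  have E : forall m, Z.min A B <= m -> D m = l * m.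
    apply: upward_ind_from => [|m Hm IH]; first by rewrite HA; lia.
    by rewrite HS IH wz; lia.
  by have := E B; have := HB B; lia.
move=> HL; have Ht := assembled_head Hf.
have Haf := head_admissible Ht Hl0 Hx.
have l0l := assembled_le (assembled_cons Hf Hl0 Hx Hw HD Hi) Ha.
have hl0 : 0 <= l0 <= k by lia.
have hl : 0 <= l <= k by lia.
have Hll : 1 <= l0 <= l by lia.
have [H0 [B0 HB0]] := crossing_limit hl0 Haf (proj1 Ht) Hw HD.
have [R HR] := inserted_far Hl0 Haf (proj1 Ht) Hw HD (ex_intro _ B0 HB0).
pose n := Z.to_nat (R - rho).
have [b Hb] := inserted_exists f D (rho + Z.of_nat n).
have [i [Fb Lb Zb _]] := HR (rho + Z.of_nat n) b ltac:(lia) Hb.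
have [v [E [Hv [HE [B HB]]]]] := total_lag_inserted Hll (proj2 Hl) Hf Hx Hw HD Hi Hb HL.
have Haf' := admissible_mono (proj2 Hll) Haf.
have [v' [E' [H' [Hv' [HE' [B' HB']]]]]] := total_lag_exists hl Haf' (proj1 Ht).
have EH' : H' = lag_sum k l x.
  by apply: IH => //; exists v', E'; do 2 split => //; exists B'.
have Hxn : may_precede l0 (rho + Z.of_nat n) x.
  by case: x Hx {Hf Ht IH EH' l0l} => [//|[l' r] x] /=; lia.
have [j Hc] := cut_exists (rho + Z.of_nat n) Hl0 Haf (proj1 Ht) Hw HD.
have [Hab _] := insert_above_head Ht Hl0 Hxn Hw HD Hb Hc.
have [S0 [_ Z0]] := Fb.
have hl00 : 0 <= l0 <= l by lia.
have gl m : m < i -> f m = b m by rewrite -Lb; have := left_ofE b i m; lia.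
have gr m : i <= m -> f m = 0 by rewrite -Lb; have := left_ofE b i m; lia.
have [C HC] := crossing_free hl00 (proj2 Hl) (admissible_mono (proj2 Hll) Hab) S0 Z0 Zb gl gr
  Haf' Hv HE Hv' HE'.
have [K [KC [KB KB']]] : exists K, C <= K /\ B <= K /\ B' <= K.
  by exists (Z.max C (Z.max B B')); lia.
have -> : lag_sum k l (cons (l0, rho) x) = pair_lag k l l0 + lag_sum k l x by [].
have := HC K KC; rewrite HB // HB' // /pair_lag -EH'; lia.
Qed.

Lemma assembled_uncons k a l rho x : assembled k a (cons (l, rho) x) ->
  exists f w D, assembled k f x /\ 1 <= l <= k /\ may_precede l rho x /\
    greedy k (k - l) f w /\ crossing k l f w D /\ inserted f D rho a.
Proof.
move=> H; inversion_clear H as [|f ? ? ? w D ? H1 H2 H3 H4 H5 H6].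
by exists f, w, D.
Qed.

Lemma may_precede_mono l rho rho' x : rho <= rho' ->
  may_precede l rho x -> may_precede l rho' x.
Proof. by case: x => [//|[l' r] x] /=; lia. Qed.

(** What one step of the recursive definition of [iota] reads off, at whatever
    time the particle is found to be free. *)
Lemma assembled_evolution k a l rho x F I : assembled k a (cons (l, rho) x) ->
  evolution k l F I -> F O = a ->
  exists f, assembled k f x /\
    (exists T, forall t, (T <= t)%nat -> free_particle l (F t) (I t)) /\
    forall t, free_particle l (F t) (I t) ->
      left_of (F t) (I t) = f /\
      (I t + 1) * l - F t (I t) - Z.of_nat t - lag_sum k l x = rho.
Proof.
move=> /assembled_uncons [f [w [D [Hf [Hl [Hx [Hw [HD Hi]]]]]]]] HE H0.
have Ht := assembled_head Hf; have Ha := head_admissible Ht Hl Hx.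
have hl : 0 <= l <= k by lia.
have HF t : inserted f D (rho + Z.of_nat t) (F t).
  elim: t => [|t IH]; first by rewrite Z.add_0_r H0.
  have Hxt : may_precede l (rho + Z.of_nat t) x by apply: may_precede_mono Hx; lia.
  have [i Hc] := cut_exists (rho + Z.of_nat t) Hl Ha (proj1 Ht) Hw HD.
  have [_ Hli] := insert_above_head Ht Hl Hxt Hw HD IH Hc.
  have [_ [Hlt ->]] := HE t; rewrite (last_critical_uniq Hlt Hli).
  have -> : rho + Z.of_nat (S t) = rho + Z.of_nat t + 1 by lia.
  exact: (inserted_step hl Ha Hw HD IH Hc).
have [H HB] := crossing_limit hl Ha (proj1 Ht) Hw HD.
have HH : H = lag_sum k l x.
  by apply: (assembled_lag Hf Hl Ha); exists w, D.
have [R HR] := inserted_far Hl Ha (proj1 Ht) Hw HD HB.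
exists f; split=> //.
have far t : R <= rho + Z.of_nat t -> [/\ free_particle l (F t) (I t),
    left_of (F t) (I t) = f & (I t + 1) * l - F t (I t) = rho + Z.of_nat t + H].
  move=> Hr; have [i [H1 H2 _ H3]] := HR _ _ Hr (HF t).
  have [Hat [Hlt _]] := HE t.
  by rewrite (last_critical_uniq Hlt (free_last_critical Hl Hat H1)).
split; first by exists (Z.to_nat (R - rho)) => t Hr; have [] := far t ltac:(lia).
move=> t Hft; pose s := Z.to_nat (R - rho).
have [_ [H2 H3]] := evolution_stays_free s Hl HE Hft.
have [_ H4 H5] := far (t + s)%nat ltac:(lia).
by split; [rewrite -H2|lia].
Qed.

(** Wait until the free particle is so far out that it is an insertion into [f]
    of an allowed rigging, then go back in time. *)
Lemma assembled_of_free k l F I t f x : 1 <= l <= k -> evolution k l F I ->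
  free_particle l (F t) (I t) -> left_of (F t) (I t) = f -> admissible k l f ->
  assembled k f x -> exists rho, assembled k (F O) (cons (l, rho) x).
Proof.
move=> Hl HE Hft Ef Ha Hf.
have Ht := assembled_head Hf.
have hl : 0 <= l <= k by lia.
have [w [D [H [Hw [HD HB]]]]] := total_lag_exists hl Ha (proj1 Ht).
have [M HM] := free_inserted Hl Ha Hw HD HB.
pose d := (I t + 1) * l - F t (I t).
have [r Hr] : exists r, forall rho, r <= rho -> may_precede l rho x.
  have := assembled_le Hf Ha; case: x Hf Ht => [|[l' r] x] _ _ Hle /=; first by exists 0.
  by exists r => rho; lia.
(* waiting time: the position passes [M] and the rigging reaches [r] *)
pose s := Z.to_nat (Z.max (Z.max 0 ((M + 1) * l - d)) (r - d + H)).
have [S1 [S2 S3]] := evolution_stays_free s Hl HE Hft.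
rewrite -/d Ef in S2 S3.
have [Has _] := HE (t + s)%nat.
have MI : M <= I (t + s)%nat.
  have := adm_ge0 Has (I (t + s)%nat).
  have : (M + 1) * l <= (I (t + s)%nat + 1) * l - F (t + s)%nat (I (t + s)%nat) by lia.
  nia.
have Hi := HM _ _ MI Has S1 S2.
exists (d - H - Z.of_nat t).
have E : (I (t + s)%nat + 1) * l - F (t + s)%nat (I (t + s)%nat) - H =
  d - H - Z.of_nat t + Z.of_nat (t + s) by lia.
rewrite E in Hi.
have Hx : may_precede l (d - H - Z.of_nat t + Z.of_nat (t + s)) x by apply: Hr; lia.
have [Hx0 Hi0] := evolution_back Hf Hl Hw HD HE Hx Hi.
exact: (assembled_cons Hf Hl Hx0 Hw HD Hi0).
Qed.

(** The sum of [f] over Z is [n]; [N] is its sequence of prefix sums. *)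
Definition mass (f : Z -> Z) (n : Z) : Prop :=
  exists N, [/\ forall m, N (m + 1) = N m + f m,
    exists A, forall m, m <= A -> N m = 0 &
    exists B, forall m, B <= m -> N m = n].

Lemma mass_uniq f n n' : mass f n -> mass f n' -> n = n'.
Proof.
move=> [N [HN [A HA] [B HB]]] [N' [HN' [A' HA'] [B' HB']]].
pose m0 := Z.min A A'.
have E : forall m, m0 <= m -> N m = N' m.
  apply: upward_ind_from => [|m Hm IH]; first by rewrite HA ?HA' //; lia.
  by rewrite HN HN' IH.
pose m1 := Z.max m0 (Z.max B B').
by have := E m1; have := HB m1; have := HB' m1; lia.
Qed.

Lemma assembled_mass k f x : assembled k f x ->
  mass f (List.fold_right (fun p s => fst p + s) 0 x).
Proof.
elim=> {f x} [|f x l rho w D a Hf [N [HN [A HA] [B HB]]] Hl Hx Hw HD Hi] /=.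
  by exists (fun=> 0); split; [lia|exists 0; lia|exists 0; lia].
have Ht := assembled_head Hf; have Ha := head_admissible Ht Hl Hx.
have hl : 0 <= l <= k by lia.
have [H [C HC]] := crossing_limit hl Ha (proj1 Ht) Hw HD.
have [[A' HA'] _] := HD.
exists (fun m => N m + Z.max (D m - rho) 0 - Z.max (D (m - 1) - rho) 0); split.
- by move=> m; rewrite Hi HN; idx; lia.
- exists (Z.min (Z.min A A') (Z.min 0 rho)) => m Hm.
  have : l * m <= m by nia.
  by rewrite HA ?HA' ?HA'; lia.
- exists (Z.max (Z.max B (C + 1)) (Z.max 1 (rho + H) + 1)) => m Hm.
  have : m - 1 <= l * (m - 1) by nia.
  by rewrite HB ?HC ?HC; lia.
Qed.

Lemma mass_left_of f n l i : free_particle l f i -> mass f n ->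
  mass (left_of f i) (n - l).
Proof.
move=> [S0 [_ Z0]] [N [HN [A HA] [B HB]]].
exists (fun m => if Z.ltb m i then N m else N i); split.
- move=> m; have := left_ofE f i m; have := HN m.
  case: (Z.ltb_spec (m + 1) i); case: (Z.ltb_spec m i); try lia.
  move=> H1 H2; have -> : i = m + 1 by lia.
  lia.
- by exists (Z.min A (i - 1)) => m Hm; case: (Z.ltb_spec m i) => ?; rewrite HA; lia.
- exists i => m Hm; case: (Z.ltb_spec m i) => [|_]; first lia.
  have : forall m, i + 2 <= m -> N m = N i + l.
    apply: upward_ind_from => [|m' Hm' IH]; last by rewrite HN Z0 // IH; lia.
    by have := HN i; have := HN (i + 1); idx; lia.
  by move=> /(_ (Z.max B (i + 2))); rewrite HB; lia.
Qed.

Definition energies_ge0 (x : list (Z * Z)) : Prop :=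
  List.Forall (fun p => 0 <= snd p) x.

Definition max_excess (c : Z) (x : list (Z * Z)) : Z :=
  List.fold_right (fun p s => Z.max (c * fst p - snd p) s) 0 x.

(** The values D_0 = 0, D_1 = l - f_0, D_2 = 2l - 2 f_0 - f_1 turn the insertion
    formula into maxima.  Conversely, if [a] vanishes in negative columns, then
    so do [f] and the slopes of max (D - rho, 0) there, because these slopes are
    non-negative, start from 0 and decrease by [f]. *)
Lemma assembled_left_end k a x : assembled k a x ->
  (energies_ge0 x -> (forall m, m < 0 -> a m = 0) /\ a 0 = max_excess 1 x /\
     2 * a 0 + a 1 = max_excess 2 x) /\
  ((forall m, m < 0 -> a m = 0) -> energies_ge0 x).
Proof.
elim=> {a x} [|f x l rho w D a Hf [IH1 IH2] Hl Hx Hw HD Hi].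
  by split=> _; [|exact: List.Forall_nil].
have Ht := assembled_head Hf; have Ha := head_admissible Ht Hl Hx.
have hl : 0 <= l <= k by lia.
have hd : 0 <= k - l by lia.
have wz := greedy_finite hd Ha Hw.
have D0 : (forall m, m < 0 -> f m = 0) -> forall m, m <= 0 -> D m = l * m.
  move=> Hz m Hm; have [[A HA] HS] := HD.
  case: (Z.le_gt_cases m A) => H1; first exact: HA.
  have H2 : Z.min A 0 <= m by lia.
  move: m H2 Hm {H1}; apply: upward_ind_from => [_|m Hm IH Hm0]; first by rewrite HA; lia.
  by rewrite HS IH ?wz ?Hz; try apply: Hz; lia.
split.
- move=> /List.Forall_cons_iff [Hr Hxs]; rewrite /= in Hr.
  have [Hz [E1 E2]] := IH1 Hxs; have {}D0 := D0 Hz.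
  have d0 := D0 0 ltac:(lia); have d1 := D0 (-1) ltac:(lia).
  have z2 := Hz (-2) ltac:(lia); have z1 := Hz (-1) ltac:(lia).
  have [_ HS] := HD; have S0 := HS 0; have S1 := HS 1.
  rewrite /= (wz _ z2) z2 z1 in S0; rewrite /= (wz _ z1) z1 in S1.
  split; last first.
    have -> : max_excess 1 (cons (l, rho) x) = Z.max (1 * l - rho) (max_excess 1 x) by [].
    have -> : max_excess 2 (cons (l, rho) x) = Z.max (2 * l - rho) (max_excess 2 x) by [].
    have := Hi 0; have := Hi 1.
    have -> : 1 + 1 = 2 by []. have -> : 0 + 1 = 1 by []. have -> : 1 - 1 = 0 by [].
    have -> : 0 - 1 = -1 by [].
    by lia.
  by move=> m Hm; rewrite Hi Hz // !D0; nia.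
- move=> Az.
  have M := crossing_mono hl Ha Hw HD.
  have [[A HA] HS] := HD.
  (* left of [m0] the thresholds l m are already below [rho] *)
  pose m0 := Z.min (Z.min A 0) (Z.min 0 rho) - 1.
  have e0 m : m <= m0 + 1 -> Z.max (D m - rho) 0 = 0.
    by move=> Hm; rewrite HA; nia.
  have E : forall m, m0 <= m -> m < 0 -> Z.max (D (m + 1) - rho) 0 = 0 /\ Z.max (D m - rho) 0 = 0.
    apply: upward_ind_from => [_|m Hm IH Hm0]; first by rewrite !e0; lia.
    have [I1 I2] := IH ltac:(lia); split => //.
    have := Hi (m + 1); rewrite Az; last lia.
    by idx; have := adm_ge0 Ha (m + 1); lia.
  have Hz m : m < 0 -> f m = 0.
    move=> Hm; have := Hi m; rewrite Az //.
    case: (Z.le_gt_cases m m0) => Hm1; first by rewrite !e0; lia.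
    have := E m; have := E (m - 1); idx; lia.
  constructor; last exact: IH2.
  by have := D0 Hz 0; have := E (-1); rewrite /=; lia.
Qed.

Lemma mass_right_move f n i : mass f n -> mass (right_move f i) n.
Proof.
move=> [N [HN [A HA] [B HB]]].
exists (fun m => N m - (if Z.eqb m (i + 1) then 1 else 0)); split.
- move=> m; rewrite HN /right_move; cases_test.
- by exists (Z.min A i) => m Hm; rewrite HA; [cases_test|]; lia.
- by exists (Z.max B (i + 2)) => m Hm; rewrite HB; [cases_test|]; lia.
Qed.

(** * The given configurations *)

(** The configuration on Z, where linear arithmetic applies directly. *)
Definition fz (c : config) : Z -> Z := fun z => Z.of_nat (c (int_of_Z z)).

Lemma fzE c i : fz c (Z_of_int i) = Z.of_nat (c i).
Proof. by rewrite /fz Z_of_intK. Qed.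

Lemma fz_offset c i (n : Z) (j : int) : Z_of_int j = Z.add (Z_of_int i) n ->
  fz c (Z.add (Z_of_int i) n) = Z.of_nat (c j).
Proof. by move=> <-; rewrite fzE. Qed.

Lemma fz_window c i :
  [/\ fz c (Z_of_int i - 1) = Z.of_nat (c (i - 1)%R),
      fz c (Z_of_int i + 1) = Z.of_nat (c (i + 1)%R) &
      fz c (Z_of_int i + 2) = Z.of_nat (c (i + 2)%R)].
Proof. by split; apply: fz_offset; lia. Qed.

Lemma fz_inj c c' : fz c = fz c' -> c = c'.
Proof.
move=> E; apply/fsfunP => i; have := fzE c i; rewrite E fzE; lia.
Qed.

Lemma fz_finite c : finite (fz c).
Proof.
suff [B HB] : exists B : nat, forall i, i \in finsupp c -> (`|i| <= B)%N.
  exists (Z.of_nat B) => m Hm; rewrite /fz.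
  case: (finsuppP c (int_of_Z m)) => // /HB; lia.
exists (\max_(i <- finsupp c) `|i|%N) => i Hi.
exact: (leq_bigmax_seq (F := fun i : int => `|i|%N) i Hi).
Qed.

Lemma Ckl_admissible k l c : Ckl k l c <-> admissible (Z.of_nat k) (Z.of_nat l) (fz c).
Proof.
split=> [[HT HSL]|[_ HT HS HL]].
- split=> z; [rewrite /fz; lia| | |]; rewrite -[z]int_of_ZK.
  + have [_ -> ->] := fz_window c (int_of_Z z); rewrite fzE.
    by have := HT (int_of_Z z); lia.
  + have [_ -> _] := fz_window c (int_of_Z z); rewrite fzE.
    by have [+ _] := HSL (int_of_Z z); rewrite /S2; lia.
  + have [-> -> ->] := fz_window c (int_of_Z z); rewrite fzE.
    by have [_] := HSL (int_of_Z z); rewrite /L4; lia.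
- split=> [i|i].
  + have := HT (Z_of_int i); have [_ -> ->] := fz_window c i; rewrite fzE; lia.
  + have := HS (Z_of_int i); have := HL (Z_of_int i).
    by have [-> -> ->] := fz_window c i; rewrite fzE /S2 /L4; lia.
Qed.

Lemma critical_fz k l c i : (S2 i c = l \/ L4 i c = (k + l)%N) <->
  critical (Z.of_nat k) (Z.of_nat l) (fz c) (Z_of_int i).
Proof.
rewrite /critical /S2 /L4; have [-> -> ->] := fz_window c i; rewrite fzE; lia.
Qed.

Lemma last_crit_fz k l c j : last_critical (Z.of_nat k) (Z.of_nat l) (fz c) j ->
  last_crit k l c = int_of_Z j.
Proof.
move=> [cj Hj].
have Hmax i : S2 i c = l \/ L4 i c = (k + l)%N -> (i <= int_of_Z j)%R.
  move=> /critical_fz Hi; case: (Z.le_gt_cases (Z_of_int i) j) => H; first lia.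
  by have := Hj (Z_of_int i) ltac:(lia); move: Hi; unfold critical, noncritical; lia.
apply: xget_unique; first by split=> //; apply/critical_fz; rewrite int_of_ZK.
move=> i [Hi Hi2]; apply/eqP; rewrite eq_le Hmax //=; apply: Hi2.
by apply/critical_fz; rewrite int_of_ZK.
Qed.

Lemma Mplus_fz (k l : nat) c j : (1 <= l <= k)%N ->
  admissible (Z.of_nat k) (Z.of_nat l) (fz c) ->
  last_critical (Z.of_nat k) (Z.of_nat l) (fz c) j ->
  fz (Mplus k l c) = right_move (fz c) j.
Proof.
move=> Hl Ha Hj; apply: functional_extensionality => z.
have -> : fz (Mplus k l c) z = Z.of_nat
   (if int_of_Z z == int_of_Z j then (c (int_of_Z j) - 1)%N else
    if int_of_Z z == (int_of_Z j + 1)%R then (c (int_of_Z j + 1)%R + 1)%N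
    else c (int_of_Z z)).
  by rewrite /fz /Mplus (last_crit_fz Hj) !fsfun_withE.
have Hl' : 1 <= Z.of_nat l <= Z.of_nat k by lia.
have := adm_ge0 (right_move_admissible Hl' Ha Hj) j.
have := right_moveE (fz c) j j; have := right_moveE (fz c) j z.
have := fzE c (int_of_Z j); rewrite int_of_ZK.
have := fzE c (int_of_Z j + 1)%R.
have -> : Z_of_int (int_of_Z j + 1)%R = Z.add j 1 by lia.
case: eqP => [E|E].
  have -> : z = j by lia.
  lia.
case: eqP => [E2|E2].
  have -> : z = Z.add j 1 by lia.
  lia.
rewrite /fz; lia.
Qed.

Lemma Mplus_evolution (k l : nat) c : (1 <= l <= k)%N ->
  admissible (Z.of_nat k) (Z.of_nat l) (fz c) ->
  (exists i, critical (Z.of_nat k) (Z.of_nat l) (fz c) i) ->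
  evolution (Z.of_nat k) (Z.of_nat l) (fun t => fz (iter t (Mplus k l) c))
    (fun t => Z_of_int (last_crit k l (iter t (Mplus k l) c))).
Proof.
move=> Hl Ha [i0 Hi0]; have Hl' : 1 <= Z.of_nat l <= Z.of_nat k by lia.
suff H t : admissible (Z.of_nat k) (Z.of_nat l) (fz (iter t (Mplus k l) c)) /\
    exists i, last_critical (Z.of_nat k) (Z.of_nat l) (fz (iter t (Mplus k l) c)) i.
  move=> t; have [Hat [i Hi]] := H t.
  rewrite (last_crit_fz Hi) int_of_ZK; do 2 split => //.
  by rewrite [iter t.+1 _ _]/= (Mplus_fz Hl Hat Hi).
elim: t => [|t [Hat [i Hi]]] /=.
  split=> //; have [j [_ Hj]] := last_critical_exists Hl' Ha (fz_finite c) Hi0.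
  by exists j.
have Ham := right_move_admissible Hl' Hat Hi; have Cm := right_move_critical (proj1 Hi).
rewrite -(Mplus_fz Hl Hat Hi) in Ham Cm.
split=> //; have [j [_ Hj]] := last_critical_exists Hl' Ham (fz_finite _) Cm.
by exists j.
Qed.

Lemma level_fz (k l : nat) c j : (1 <= l <= k)%N ->
  admissible (Z.of_nat k) (Z.of_nat l) (fz c) ->
  critical (Z.of_nat k) (Z.of_nat l) (fz c) j -> level k c = l.
Proof.
move=> Hl Ha Hj.
have big l' : admissible (Z.of_nat k) (Z.of_nat l') (fz c) -> (l <= l')%N.
  move=> Hl'; rewrite leqNgt; apply/negP => Hlt.
  have Hlt' : Z.of_nat l' < Z.of_nat l by lia.
  have := admissible_noncritical j Hlt' Hl'.
  by move: Hj; rewrite /critical /noncritical; lia.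
apply: xget_unique.
  split=> //; split; first exact/Ckl_admissible.
  by move/Ckl_admissible/big; lia.
move=> l' [Hl' [/Ckl_admissible /big Hle Hn]].
apply/eqP; rewrite eqn_leq Hle andbT leqNgt; apply/negP => Hlt; apply: Hn.
by apply/Ckl_admissible; apply: admissible_mono Ha; lia.
Qed.

Lemma free_fz l c i : free_at l c i <-> free_particle (Z.of_nat l) (fz c) (Z_of_int i).
Proof.
rewrite /free_particle; have [_ -> _] := fz_window c i; rewrite fzE.
split=> [[H1 H2 H3]|[H1 [H2 H3]]].
- split; first lia; split; first lia.
  by move=> z Hz; rewrite -[z]int_of_ZK fzE H3 //; lia.
- split; [lia|lia|] => j Hj.
  by have := H3 (Z_of_int j) ltac:(lia); rewrite fzE; lia.
Qed.

Lemma remove_fz l c i : free_at l c i ->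
  fz [fsfun c with i |-> 0%N, (i + 1)%R |-> 0%N] = left_of (fz c) (Z_of_int i).
Proof.
move=> [_ _ H3]; apply: functional_extensionality => z.
rewrite /left_of /fz !fsfun_withE.
case: eqP => [E|E].
  by have -> : (z <? Z_of_int i) = false by lia.
case: eqP => [E2|E2].
  by have -> : (z <? Z_of_int i) = false by lia.
case: Z.ltb_spec => // H.
by rewrite H3 //; lia.
Qed.

Definition pair_of (x : list (Z * Z)) : rigged_pair :=
  ([seq Z.to_nat p.1 | p <- x], [seq int_of_Z p.2 | p <- x]).

Lemma lag_sum_Amat (k l : nat) x :
  List.Forall (fun p => 0 <= fst p) x ->
  Z.of_nat (\sum_(j <- (pair_of x).1) Amat k l j)%N =
  lag_sum (Z.of_nat k) (Z.of_nat l) x.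
Proof.
elim: x => [|[l' r] x IH]; first by rewrite big_nil.
move=> /List.Forall_cons_iff [Hl' /IH {}IH].
rewrite /= in Hl'; rewrite /pair_of [in X in Z.of_nat X]/= big_cons.
have -> : lag_sum (Z.of_nat k) (Z.of_nat l) (cons (l', r) x) =
  pair_lag (Z.of_nat k) (Z.of_nat l) l' + lag_sum (Z.of_nat k) (Z.of_nat l) x by [].
have E : Z.of_nat (Amat k l (Z.to_nat l')) = pair_lag (Z.of_nat k) (Z.of_nat l) l'.
  by rewrite /Amat /pair_lag; lia.
by rewrite -IH -E; exact: Nat2Z.inj_add.
Qed.

Lemma assembled_forall k f x : assembled k f x ->
  List.Forall (fun p => 1 <= fst p <= k) x.
Proof. by elim=> {f x} [|f x l rho w D a _ IH Hl _ _ _ _]; constructor. Qed.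

Lemma iota_rec_assembled (k n : nat) c x :
  assembled (Z.of_nat k) (fz c) x -> (size x <= n)%N ->
  iota_rec k n c = pair_of x.
Proof.
elim: x n c => [|[l0 rho] x IH] n c Hc Hn.
  have [_ /= Hz] := assembled_head Hc.
  case: n Hn => [//|n] _ /=; case: eqP => // [[]].
  by apply: fz_inj; rewrite Hz; apply: functional_extensionality => z; rewrite /fz fsfunE.
case: n Hn => [//|n] Hn.
have [_ [Hl0 [Ha [j [[Cj _] _]]]]] := assembled_head Hc.
have [l El] : exists l, l0 = Z.of_nat l by exists (Z.to_nat l0); lia.
subst l0; have Hl : (1 <= l <= k)%N by lia.
have Hlev := level_fz Hl Ha Cj.
have HE := Mplus_evolution Hl Ha (ex_intro _ j Cj).
have [f [Hf [[T0 HT0] HF]]] := assembled_evolution Hc HE erefl.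
rewrite /=; case: eqP => [E|_].
  exfalso; move: Cj; rewrite E /critical /fz !fsfunE; lia.
rewrite Hlev.
have Hfree : forall t, (free_time k l c <= t)%N ->
    exists i, free_at l (iter t (Mplus k l) c) i.
  have : exists T, forall t, (T <= t)%N -> exists i, free_at l (iter t (Mplus k l) c) i.
    exists T0 => t Ht; have H := HT0 t ltac:(lia).
    by eexists; apply/free_fz; exact: H.
  exact: (@xgetPex _ 0%N [set T | forall t, (T <= t)%N ->
    exists i, free_at l (iter t (Mplus k l) c) i]%classic).
set t := free_time k l c in Hfree *; set m := iter t (Mplus k l) c.
have [i0 Hi0] := Hfree t (leqnn t).
have Huniq i : free_at l m i -> i = last_crit k l m.
  move=> /free_fz Hi; have [Hat [Hlt _]] := HE t.
  have := last_critical_uniq (free_last_critical Hl0 Hat Hi) Hlt.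
  by rewrite -/m; lia.
have -> : xget 0%R [set i | free_at l m i]%classic = last_crit k l m.
  by apply: xget_unique => //=; rewrite -(Huniq _ Hi0).
have Hfr : free_at l m (last_crit k l m) by rewrite -(Huniq _ Hi0).
set i := last_crit k l m in Hfr *.
have [Hleft Hrho] := HF t (proj1 (free_fz _ _ _) Hfr).
rewrite -/m -/i in Hleft Hrho.
rewrite (IH n) //; last by rewrite (remove_fz Hfr) Hleft.
have Hx := assembled_forall Hf.
have Hx0 : List.Forall (fun p => 0 <= fst p) x.
  by apply: List.Forall_impl Hx => p; lia.
have L := lag_sum_Amat k l Hx0.
rewrite /pair_of /=; congr pair; congr cons; first lia.
have [H1 _ _] := Hfr; rewrite fzE in Hrho.
move: L Hrho; set A := (\sum_(_ <- _) _)%N; lia.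
Qed.

(** The weight is the fuel of the recursion, so it must bound the number of
    particles; this compares it with the total mass of an assembled list. *)
Lemma mass_weight c : mass (fz c) (Z.of_nat (weight c)).
Proof.
have H (s : seq int) : uniq s ->
    mass (fun z => if int_of_Z z \in s then fz c z else 0)
         (Z.of_nat (\sum_(i <- s) c i)%N).
  elim: s => [_|i s IH /=/andP[Hi /IH [N [HN [A HA] [B HB]]]]].
    by exists (fun=> 0); split; [|exists 0|exists 0] => * //=; rewrite ?big_nil; lia.
  exists (fun z => N z + (if Z.ltb (Z_of_int i) z then Z.of_nat (c i) else 0)).
  split.
  - move=> z; rewrite HN inE; case: eqP => [E|E].
      have Ez : z = Z_of_int i by lia.
      rewrite E (negbTE Hi) -fzE -Ez /=.
      by cases_test; lia.
    rewrite /=; set u := (if _ then fz c z else _).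
    by cases_test; lia.
  - by exists (Z.min A (Z_of_int i)) => z Hz; rewrite HA; last lia; cases_test; lia.
  - exists (Z.max B (Z_of_int i + 1)) => z Hz; rewrite HB ?big_cons; last lia.
    by cases_test; lia.
have -> : fz c = fun z => if int_of_Z z \in finsupp c then fz c z else 0.
  apply: functional_extensionality => z; rewrite mem_finsupp /fz.
  by case: eqP => //= ->.
exact/H/fset_uniq.
Qed.

Lemma iota_assembled (k : nat) c x : assembled (Z.of_nat k) (fz c) x ->
  iotaC k c = pair_of x.
Proof.
move=> Hc; apply: iota_rec_assembled => //.
have := mass_uniq (assembled_mass Hc) (mass_weight c).
suff : Z.of_nat (size x) <= List.fold_right (fun p s => fst p + s) 0 x by lia.
have {Hc} := assembled_forall Hc; elim=> [//|[l r] {}x [Hl _] _ IH] /=.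
by rewrite /= in Hl; lia.
Qed.

(** * The image of the map *)

(** Induction on the weight, and inside it on a bound [l] for the level: either
    some site is critical at level [l], and a particle of weight [l] can be
    driven out, or the level is smaller. *)
Lemma assembled_complete (k : nat) n (l : nat) c : (l <= k)%N ->
  admissible (Z.of_nat k) (Z.of_nat l) (fz c) -> mass (fz c) (Z.of_nat n) ->
  exists x, assembled (Z.of_nat k) (fz c) x.
Proof.
elim/ltn_ind: n l c => n IHn; elim=> [|l IHl] c Hl Ha Hm.
  exists [::]; have -> : fz c = fun=> 0; last exact: assembled_nil.
  apply: functional_extensionality => z; have := adm_pair Ha z.
  by have := adm_ge0 Ha z; have := adm_ge0 Ha (z + 1); lia.
have [Hc|Hc] := classic (exists i, critical (Z.of_nat k) (Z.of_nat l.+1) (fz c) i); last first.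
  apply: IHl => //; first lia.
  have Q i : ~ critical (Z.of_nat k) (Z.of_nat l.+1) (fz c) i.
    by move=> Hi; apply: Hc; exists i.
  split; [exact: adm_ge0 Ha|exact: adm_triple Ha| |] => i; have := Q i; rewrite /critical.
  - by have := adm_pair Ha i; lia.
  - by have := adm_quad Ha i; lia.
have Hl1 : (1 <= l.+1 <= k)%N by lia.
have Hlz : 1 <= Z.of_nat l.+1 <= Z.of_nat k by lia.
have HE := Mplus_evolution Hl1 Ha Hc.
have [B HB] := fz_finite c.
have [t Ht] := evolution_free (R := B) Hlz HE (fz_finite c) ltac:(by move=> z Hz /=; apply: HB; lia).
have Hfr := proj2 (free_fz _ _ _) Ht.
have Hm' : mass (fz (iter t (Mplus k l.+1) c)) (Z.of_nat n).
  elim: t {Ht Hfr} => [//|t IHt]; have [_ [_ ->]] := HE t; exact: mass_right_move.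
have {}Hm' := mass_left_of Ht Hm'.
have [Hat _] := HE t.
set m := iter t _ _ in Ht Hfr Hm' Hat.
have Eg := remove_fz Hfr.
set g := app_fsdelta _ _ in Eg.
have Hag : admissible (Z.of_nat k) (Z.of_nat l.+1) (fz g).
  rewrite Eg; set i := Z_of_int _.
  split=> s; have := left_ofE (fz m) i s; have := left_ofE (fz m) i (s + 1);
    have := left_ofE (fz m) i (s + 2); have := left_ofE (fz m) i (s - 1);
    have := adm_ge0 Hat (s - 1); have := adm_ge0 Hat s;
    have := adm_ge0 Hat (s + 1); have := adm_ge0 Hat (s + 2).
  - lia.
  - have := adm_triple Hat s; lia.
  - have := adm_pair Hat s; lia.
  - have := adm_quad Hat s; lia.
have Hmg := mass_weight g; rewrite -Eg in Hm'.
have Hw := mass_uniq Hmg Hm'.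
have [x Hx] := IHn (weight g) ltac:(lia) l.+1 g Hl Hag Hmg.
have [rho Hrho] := assembled_of_free Hlz HE Ht (esym Eg) Hag Hx.
by exists ((Z.of_nat l.+1, rho) :: x).
Qed.

Lemma fz_surj f : finite f -> (forall z, 0 <= f z) -> exists c, fz c = f.
Proof.
move=> [B HB] H0.
have H n : exists c : config, forall z, fz c z =
    if Z.leb (- B) z && Z.ltb z (- B + Z.of_nat n) then f z else 0.
  elim: n => [|n [c Hc]].
    exists [fsfun] => z; rewrite /fz fsfunE.
    by case: Z.leb_spec => // ?; case: Z.ltb_spec => //; lia.
  exists [fsfun c with int_of_Z (- B + Z.of_nat n) |-> Z.to_nat (f (- B + Z.of_nat n))].
  move=> z; rewrite /fz fsfun_withE; case: eqP => [E|E].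
    have -> : z = - B + Z.of_nat n by lia.
    have -> : (- B <=? - B + Z.of_nat n) = true by lia.
    have -> : (- B + Z.of_nat n <? - B + Z.of_nat n.+1) = true by lia.
    by have := H0 (- B + Z.of_nat n); rewrite /=; lia.
  have := Hc z; rewrite /fz => ->.
  have -> : (z <? - B + Z.of_nat n.+1) = (z <? - B + Z.of_nat n) by lia.
  by [].
have [c Hc] := H (Z.to_nat (2 * B + 1)).
exists c; apply: functional_extensionality => z; rewrite Hc.
case: Z.leb_spec => H1; last by rewrite HB //; lia.
by case: Z.ltb_spec => H2 //=; rewrite HB //; lia.
Qed.

Fixpoint rigged_list (k : Z) (x : list (Z * Z)) : Prop :=
  match x with
  | nil => True
  | cons (l, rho) x' => 1 <= l <= k /\ may_precede l rho x' /\ rigged_list k x'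
  end.

Lemma assembled_rigged_list k f x : assembled k f x -> rigged_list k x.
Proof. by elim=> {f x} [|f x l rho w D a _ IH Hl Hx _ _ _]. Qed.

Lemma rigged_list_assembled k x : rigged_list k x -> exists f, assembled k f x.
Proof.
elim: x => [_|[l rho] x IH /= [Hl [Hx /IH [f Hf]]]].
  by exists (fun=> 0); exact: assembled_nil.
exact: assembled_exists_cons Hf Hl Hx.
Qed.

Lemma rigged_list_weaken k l x : rigged_list k x ->
  match x with nil => True | cons (l', _) _ => l' <= l end -> rigged_list l x.
Proof.
elim: x => [//|[l' r] x IH] /= [Hl [Hx Hv]] Hle; split; first lia; split=> //.
by apply: IH => //; case: x Hx {Hv} => [//|[l2 r2] x] /=; lia.
Qed.

Lemma rigged_cons (l : nat) s (r : int) t : rigged (l :: s, r :: t) <->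
  [/\ (1 <= l)%N, rigged (s, t) &
   match s, t with l' :: _, r' :: _ => (l' <= l)%N /\ (l = l' -> (r' <= r)%R)
   | _, _ => True end].
Proof.
split.
- move=> [/= /eqP]; rewrite eqSS => /eqP Hsz Hs /andP[Hl Hall] Hr; split=> //.
    split=> //; first exact: path_sorted Hs.
    by move=> i Hi; exact: (Hr i.+1).
  case: s t Hsz Hs Hall Hr => [|l' s] [|r' t] //= _ /andP[Hl' _] _ Hr; split=> //.
  by move=> E; apply: (Hr 0%N).
- move=> [Hl [/= Hsz Hs Hall Hr] Hst]; split=> /=; first by rewrite Hsz.
  + case: s t Hst Hs Hsz {Hr Hall} => [//|l' s] [//|r' t] [Hle _] Hs _ /=.
    by rewrite /geq /= Hle.
  + by rewrite Hl.
  + case=> [|i] Hi; last exact: Hr.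
    case: s t Hst Hsz Hi {Hs Hr Hall} => [//|l' s] [//|r' t] [_ Hst] _ _ /=.
    exact: Hst.
Qed.

Lemma rigged_pair_of (l : nat) y : Rl l y <->
  exists x, rigged_list (Z.of_nat l) x /\ y = pair_of x.
Proof.
split.
- case: y => s t [] ; elim: s t => [|a s IH] [|r t] Hr Hh.
  + by exists [::].
  + by case: Hr.
  + by case: Hr.
  + move/rigged_cons: Hr => [Ha Hst Hfit]; rewrite /= in Hh.
    have [x [Hx Ex]] : exists x, rigged_list (Z.of_nat l) x /\ (s, t) = pair_of x.
      by apply: IH => //; case: s t Hst Hfit => [|a' s] [|r' t] //=; [case|lia].
    exists ((Z.of_nat a, Z_of_int r) :: x); split.
      split; first lia; split=> //.
      case: x Ex Hx => [//|[a' r'] x] [Es Et] /= [Ha' _].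
      rewrite Es Et /= in Hfit; lia.
    by rewrite /pair_of /= Nat2Z.id Z_of_intK; case: Ex => -> ->.
- move=> [x [Hx ->]]; elim: x Hx => [//|[a r] x IH] /= [Ha [Hx /IH [H1 H2]]].
  split; last by rewrite /=; lia.
  apply/rigged_cons; split; [by rewrite /=; lia|exact: H1|].
  by case: x Hx {IH H1 H2} => [//|[a' r'] x] /=; lia.
Qed.

Lemma fz_0 c : fz c 0 = Z.of_nat (c 0%R). Proof. exact: (fzE c 0%R). Qed.

Lemma fz_1 c : fz c 1 = Z.of_nat (c 1%R). Proof. exact: (fzE c 1%R). Qed.

(** The right-hand side no longer mentions [k]. *)
Lemma bracket_pair_of (k l a b : nat) y : (1 <= l <= k)%N ->
  bracket k l a b y <-> exists x,
    [/\ y = pair_of x, rigged_list (Z.of_nat l) x, energies_ge0 x,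
        Z.of_nat a = max_excess 1 x &
        2 * Z.of_nat a + Z.of_nat b = max_excess 2 x].
Proof.
move=> Hl; split.
- move=> [c [[/Ckl_admissible Ha Hpos] Hca Hcb] <-].
  have Hlk : (l <= k)%N by lia.
  have [x Hx] := assembled_complete Hlk Ha (mass_weight c).
  exists x; rewrite (iota_assembled Hx).
  have [E1 E2] := assembled_left_end Hx.
  have Hz z : z < 0 -> fz c z = 0.
    by move=> Hz; rewrite -[z]int_of_ZK fzE Hpos //; lia.
  have He := E2 Hz; have [_ [F1 F2]] := E1 He.
  rewrite fz_0 in F1; rewrite fz_0 fz_1 in F2.
  split=> //; [|by rewrite -F1 Hca|by rewrite -F2 Hca Hcb].
  exact: (rigged_list_weaken (assembled_rigged_list Hx) (assembled_le Hx Ha)).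
- move=> [x [-> Hx He Ea Eb]].
  have Hxk : rigged_list (Z.of_nat k) x.
    by apply: (rigged_list_weaken Hx); case: x Hx {He Ea Eb} => [//|[l' r'] x] /=; lia.
  have [f Hf] := rigged_list_assembled Hxk.
  have Ht := assembled_head Hf.
  have Haf : admissible (Z.of_nat k) (Z.of_nat l) f.
    case: x Hx Ht {Hxk Hf He Ea Eb} => [|[l' r'] x] Hx [_] => [->|[_ [Ha _]]].
      by apply: admissible_zero; lia.
    by apply: admissible_mono Ha; move: Hx => /=; lia.
  have [c Ec] := fz_surj (proj1 Ht) (adm_ge0 Haf).
  rewrite -Ec in Hf Haf.
  exists c; last exact: iota_assembled.
  have [/(_ He) [E1 [E2 E3]] _] := assembled_left_end Hf.
  rewrite fz_0 in E2; rewrite fz_0 fz_1 in E3.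
  split; [split|lia|lia]; first exact/Ckl_admissible.
  by move=> i Hi; have := fzE c i; rewrite E1; lia.
Qed.

Lemma max_excessP c x m : max_excess c x = m <->
  [/\ 0 <= m, forall p, List.In p x -> c * fst p - snd p <= m &
      m = 0 \/ exists2 p, List.In p x & c * fst p - snd p = m].
Proof.
have ub : 0 <= max_excess c x /\ forall p, List.In p x -> c * fst p - snd p <= max_excess c x.
  elim: x => [//|q x [IH0 IH]]; rewrite /max_excess /= -/(max_excess c x).
  split; first lia; by move=> p [<-|/IH]; lia.
have att : max_excess c x = 0 \/ exists2 p, List.In p x & c * fst p - snd p = max_excess c x.
  elim: x {ub} => [|q x IH]; first by left.
  rewrite /max_excess /= -/(max_excess c x).
  case: (Z.max_spec (c * fst q - snd q) (max_excess c x)) => [[_ ->]|[_ ->]].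
    by case: IH => [->|[p Hp Ep]]; [left|right; exists p => //; right].
  by right; exists q => //; left.
split=> [<-|[m0 Hm Hatt]]; first by split; [exact: (proj1 ub)|exact: (proj2 ub)|exact: att].
have [u0 Hu] := ub; case: att => [E|[p Hp Ep]]; case: Hatt => [E'|[q Hq Eq]].
- by rewrite E.
- by have := Hu q Hq; lia.
- by have := Hm p Hp; lia.
- by have := Hu q Hq; have := Hm p Hp; lia.
Qed.

Lemma rigged_list_In k x p : rigged_list k x -> List.In p x -> 1 <= fst p <= k.
Proof. by elim: x => [//|[l r] x IH] /= [Hl [_ /IH {}IH]] [<-|/IH]. Qed.

Lemma Rlr_pair_of (l : nat) r x : rigged_list (Z.of_nat l) x ->
  Rlr l r (pair_of x) <->
  forall p, List.In p x -> Z.of_nat (nth 0%N r (Z.to_nat p.1).-1) <= p.2.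
Proof.
move=> Hx; split.
- move=> [_]; rewrite size_map; elim: x {Hx} => [//|q x IH] H p [<-|Hp].
    by have := H 0%N isT; rewrite /=; lia.
  by apply: IH Hp => i Hi; exact: (H i.+1).
- move=> H; split; first by apply/rigged_pair_of; exists x.
  rewrite size_map; elim: x {Hx} H => [//|q x IH] H [|i] Hi.
    by have := H q (or_introl erefl); rewrite /=; lia.
  by apply: IH => // p Hp; apply: H; right.
Qed.

Lemma size_r_ab l a b : (a + b <= l)%N -> size (r_ab l a b) = l.
Proof.
by move=> H; rewrite !size_cat size_nseq size_iota size_map size_iota; lia.
Qed.

Lemma nth_r_ab l a b j : (a + b <= l)%N -> (1 <= j <= l)%N ->
  nth 0%N (r_ab l a b) j.-1 = (j - a + (j - (a + b)))%N.
Proof.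
move=> Hab Hj; rewrite !nth_cat size_nseq size_iota nth_nseq.
case: ltnP => H1; first lia.
case: ltnP => H2; first by rewrite nth_iota //; lia.
by rewrite (nth_map 0%N) ?size_iota ?nth_iota; lia.
Qed.

Lemma nth_bump_at r J j : (1 <= j <= size r)%N ->
  nth 0%N (bump_at r J) j.-1 = (nth 0%N r j.-1 + J j)%N.
Proof. by move=> Hj; rewrite nth_mkseq ?prednK; lia. Qed.

(** The lower bounds max (0, m - a, 2m - 2a - b) for the rigging of a particle
    of weight [m]: these are the entries of the sequence r_(a,b). *)
Definition r_ab_bounds (a b : nat) (x : list (Z * Z)) : Prop := forall p, List.In p x ->
  [/\ 0 <= p.2, p.1 - p.2 <= Z.of_nat a & 2 * p.1 - p.2 <= 2 * Z.of_nat a + Z.of_nat b].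

Lemma max_excess_r_ab (a b : nat) x :
  [/\ energies_ge0 x, Z.of_nat a = max_excess 1 x &
      2 * Z.of_nat a + Z.of_nat b = max_excess 2 x] <->
  [/\ r_ab_bounds a b x, a = 0%N \/ exists2 p, List.In p x & 1 * p.1 - p.2 = Z.of_nat a &
   (a = 0%N /\ b = 0%N) \/ exists2 p, List.In p x & 2 * p.1 - p.2 = 2 * Z.of_nat a + Z.of_nat b].
Proof.
have EF : energies_ge0 x <-> forall p, List.In p x -> 0 <= snd p.
  exact: List.Forall_forall.
split.
- move=> [/EF H0 /esym/max_excessP[_ H1 A1] /esym/max_excessP[_ H2 A2]]; split.
  + by move=> p Hp; have := H0 p Hp; have := H1 p Hp; have := H2 p Hp; split; lia.
  + by case: A1 => [?|?]; [left; lia|right].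
  + by case: A2 => [?|?]; [left; lia|right].
- move=> [H A1 A2]; split.
  + by apply/EF => p /H[].
  + apply/esym/max_excessP; split; first lia.
      by move=> p /H[]; lia.
    by case: A1 => [->|?]; [left|right].
  + apply/esym/max_excessP; split; first lia.
      by move=> p /H[].
    by case: A2 => [[-> ->]|?]; [left|right].
Qed.

Section Bounds.
Variables (l a b : nat) (x : list (Z * Z)).
Hypotheses (hab : (a + b <= l)%N) (hx : rigged_list (Z.of_nat l) x).

Lemma Rlr_r_ab : Rlr l (r_ab l a b) (pair_of x) <-> r_ab_bounds a b x.
Proof.
rewrite Rlr_pair_of //; split=> H p Hp; have := H p Hp; have Hr := rigged_list_In hx Hp.
  by rewrite nth_r_ab //; [split|]; lia.
by move=> [h0 h1 h2]; rewrite nth_r_ab //; lia.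
Qed.

(** Failing the raised bounds while satisfying the original ones means touching
    an original bound at some weight in [J]. *)
Lemma not_Rlr_bump (J : pred nat) : r_ab_bounds a b x ->
  ~ Rlr l (bump_at (r_ab l a b) J) (pair_of x) <->
  exists2 p, List.In p x & J (Z.to_nat p.1) /\
    p.2 = Z.of_nat (Z.to_nat p.1 - a + (Z.to_nat p.1 - (a + b)))%N.
Proof.
move=> Hab; rewrite Rlr_pair_of //.
have E p : List.In p x -> Z.of_nat (nth 0%N (bump_at (r_ab l a b) J) (Z.to_nat p.1).-1)
    = Z.of_nat (Z.to_nat p.1 - a + (Z.to_nat p.1 - (a + b)) + J (Z.to_nat p.1))%N.
  move=> Hp; have Hr := rigged_list_In hx Hp.
  by rewrite nth_bump_at ?size_r_ab ?nth_r_ab //; lia.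
split.
- move=> H; apply: NNPP => Hn; apply: H => p Hp; rewrite E //.
  have [h0 h1 h2] := Hab p Hp; have Hr := rigged_list_In hx Hp.
  case HJ : (J _) => /=; last lia.
  apply: Znot_gt_le => Hgt; apply: Hn; exists p => //; split=> //; lia.
- by move=> [p Hp [HJ Ep]] H; have := H p Hp; rewrite E // HJ; lia.
Qed.

(** The bound m - a is the largest of the three precisely for m between [a] and
    [a + b], and 2m - 2a - b from [a + b] on; so a contact with one of these
    lines takes place at a weight in the corresponding interval. *)
Lemma slope1_contact : r_ab_bounds a b x -> (0 < a)%N ->
  ~ Rlr l (bump_at (r_ab l a b) (itv_nat a (a + b))) (pair_of x) <->
  exists2 p, List.In p x & 1 * p.1 - p.2 = Z.of_nat a.
Proof.
move=> Hab Ha; rewrite not_Rlr_bump //.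
split=> [[p Hp [HJ Ep]]|[p Hp Ep]]; exists p => //; have Hr := rigged_list_In hx Hp.
  by move: HJ; rewrite /itv_nat; lia.
by have [h0 h1 h2] := Hab p Hp; rewrite /itv_nat; lia.
Qed.

Lemma slope2_contact : r_ab_bounds a b x ->
  ~ Rlr l (bump_at (r_ab l a b) (itv_nat (a + b) l)) (pair_of x) <->
  exists2 p, List.In p x & 2 * p.1 - p.2 = 2 * Z.of_nat a + Z.of_nat b.
Proof.
move=> Hab; rewrite not_Rlr_bump //.
split=> [[p Hp [HJ Ep]]|[p Hp Ep]]; exists p => //; have Hr := rigged_list_In hx Hp.
  by move: HJ; rewrite /itv_nat; lia.
by have [h0 h1 h2] := Hab p Hp; rewrite /itv_nat; lia.
Qed.

End Bounds.

Local Close Scope Z_scope.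

Theorem theorem4p1 (l a b : nat) (hl : 1 <= l) (hab : a + b <= l) :
  (forall k k' : nat, l <= k -> l <= k' -> bracket k l a b = bracket k' l a b)
  /\
  (forall k : nat, l <= k ->
     bracket k l a b =
       if a != 0 then
         RlrJ l (r_ab l a b) [:: itv_nat a (a + b); itv_nat (a + b) l]
       else if b != 0 then RlrJ l (r_ab l a b) [:: itv_nat b l]
       else Rlr l (r_ab l a b)).
Proof.
suff H k : l <= k -> bracket k l a b =
       if a != 0 then
         RlrJ l (r_ab l a b) [:: itv_nat a (a + b); itv_nat (a + b) l]
       else if b != 0 then RlrJ l (r_ab l a b) [:: itv_nat b l]
       else Rlr l (r_ab l a b).
  by split=> [k k' Hk Hk'|k Hk]; rewrite ?H.
move=> Hk; apply/seteqP; split => y.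
- move/bracket_pair_of; rewrite hl Hk => /(_ isT) [x [-> Hx H0 E1 E2]].
  have [Hab A1 A2] := proj1 (@max_excess_r_ab a b x) (And3 H0 E1 E2).
  have HR := proj2 (Rlr_r_ab hab Hx) Hab.
  case: eqP => Ha /=; last first.
    split=> //; rewrite !big_cons big_nil setU0 => -[].
      apply/(slope1_contact hab Hx Hab); first lia.
      by case: A1.
    apply/(slope2_contact hab Hx Hab).
    by case: A2 => // -[/Ha].
  case: eqP => Hb //=; split=> //; rewrite !big_cons big_nil setU0.
  have := slope2_contact hab Hx Hab; rewrite Ha add0n => H; apply/H.
  by rewrite Ha in A2; case: A2 => // -[_ /Hb].
- move=> Hy; apply/bracket_pair_of; first by rewrite hl.
  have HRy : Rlr l (r_ab l a b) y.
    by move: Hy; case: eqP => _ /=; [case: eqP => _ //= -[]|case].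
  have [x [Hx Ey]] := proj1 (rigged_pair_of l y) (proj1 HRy); subst y.
  have Hab := proj1 (Rlr_r_ab hab Hx) HRy.
  have [] := proj2 (@max_excess_r_ab a b x); last by move=> H0 E1 E2; exists x.
  split=> //.
  + move: Hy; case: eqP => [->|Ha] /=; first by left.
    move=> [_]; rewrite !big_cons big_nil setU0 => Hn; right.
    apply/(slope1_contact hab Hx Hab); first lia.
    by move=> H1; apply: Hn; left.
  + move: Hy; case: eqP => [Ha|_] /=.
      case: eqP => [Hb|_] /=; first by left.
      move=> [_]; rewrite !big_cons big_nil setU0 => H; right.
      by apply/(slope2_contact hab Hx Hab); move: H; rewrite Ha add0n.
    move=> [_]; rewrite !big_cons big_nil setU0 => Hn; right.
    by apply/(slope2_contact hab Hx Hab) => H2; apply: Hn; right.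
Qed.
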